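(* Let $n \ge 1$ and let $\mathcal{B}$ be a non-degenerate deformation of the type $B_n$ Coxeter arrangement in $\mathbb{R}^n$, i.e. \[\begin{aligned} \mathcal{B} = & \{x_i = a_i^{(1)},\ldots,a_i^{(r_i)} \ |\ 1 \le i \le n\} \cup \{x_i-x_j = b_{ij}^{(1)},\ldots,b_{ij}^{(s_{ij})}\ |\ 1\le i \ne j \le n\} \\ & \cup \{x_i+x_j = c_{ij}^{(1)},\ldots,c_{ij}^{(t_{ij})}\ |\ 1\le i \ne j \le n\}, \end{aligned}\] where all $a_i^{(\cdot)}, b_{ij}^{(\cdot)}, c_{ij}^{(\cdot)} \in \mathbb{R}$ and $r_i, s_{ij}, t_{ij} \ge 1$ for all indices. Then \[\chi_{\mathcal{B}}(t) = \sum_{k = 0}^{n} (-1)^{n-k}\cdot r_k(\mathcal{B}) \cdot \binom{\frac{t-1}{2}}{k},\] where $r_k(\mathcal{B})$ is the number of regions of $\mathcal{B}$ of level $k$.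
   Context: A hyperplane arrangement is a finite set of affine hyperplanes in $\mathbb{R}^n$. Its intersection poset $L(\mathcal{B})$ is the set of all nonempty intersections of hyperplanes of $\mathcal{B}$ (including $\mathbb{R}^n$ itself), ordered by reverse inclusion. The characteristic polynomial is $\chi_{\mathcal{B}}(t) = \sum_{x \in L(\mathcal{B})} \mu(\hat{0},x)\, t^{\dim x}$, where $\mu$ is the Möbius function of $L(\mathcal{B})$ and $\hat 0 = \mathbb{R}^n$. ''Non-degenerate'' means that in every direction $x_i$, $x_i - x_j$, $x_i + x_j$ ($i\neq j$) there is at least one hyperplane of $\mathcal{B}$. A region is a connected component of the complement of the union of the hyperplanes. The level of a subset $X \subset \mathbb{R}^n$ is the smallest non-negative integer $\ell$ such that $X \subset \{x \in \mathbb{R}^n : d(x,W) \le r\}$ for some linear subspace $W$ of dimension $\ell$ and some real $r>0$. Here $\binom{s}{k} = s(s-1)\cdots(s-k+1)/k!$ as a polynomial, evaluated at $s=(t-1)/2$. *)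

(* Defs.v *)
From HB Require Import structures.
From mathcomp Require Import all_boot all_order all_algebra.
From mathcomp Require Import all_classical all_reals all_analysis.
From mathcomp Require Import finmap.
Set Implicit Arguments. Unset Strict Implicit. Unset Printing Implicit Defensive.
Import Order.TTheory GRing.Theory Num.Theory.
Import numFieldNormedType.Exports.
Local Open Scope classical_set_scope.
Local Open Scope ring_scope.

Section Arr.
Variables (R : realType) (n : nat).
Notation V := 'rV[R]_n.

Definition enorm (v : V) : R := Num.sqrt (\sum_(i < n) v ord0 i ^+ 2).
Definition edist (x : V) (W : set V) : R := inf [set enorm (x - w) | w in W].

Definition rowspace (A : 'M[R]_n) : set V := [set w | (w <= A)%MS].

Definition level_ok (X : set V) (l : nat) : Prop :=
  exists A : 'M[R]_n, \rank A = l /\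
    exists2 r : R, 0 < r & X `<=` [set x | edist x (rowspace A) <= r].
Definition is_level (X : set V) (l : nat) : Prop :=
  level_ok X l /\ forall m, level_ok X m -> (l <= m)%N.

Definition affdim (X : set V) : nat :=
  xget 0%N [set l | exists (p : V) (A : 'M[R]_n),
                      \rank A = l /\ X = [set p + w | w in rowspace A]].

(** Intersection poset L(B) of an arrangement B (a set of hyperplanes, each
    given as a set of points): all nonempty intersections of subfamilies
    (the empty subfamily gives R^n), ordered by reverse inclusion. *)
Definition intersection_poset (B : set (set V)) : set (set V) :=
  [set X | exists2 S : set (set V), S `<=` B &
             X = \bigcap_(H in S) H /\ X !=set0].

(** Möbius function mu(0^, X) of L, 0^ = R^n, via the usual recursion
    mu(0^,0^) = 1, mu(0^,X) = - sum_{0^ <= Y < X} mu(0^,Y);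
    Y < X in L means X is a proper subset of Y.  The recursion is unrolled
    with a fuel parameter, which is large enough when it is > |L|. *)
Fixpoint mobius_fuel (L : set (set V)) (k : nat) (X : set V) : int :=
  match k with
  | 0%N => 0
  | k'.+1 => if X == setT then 1
             else - \sum_(Y \in [set Y | L Y /\ X `<` Y]) mobius_fuel L k' Y
  end.
Definition mobius0 (L : set (set V)) (X : set V) : int :=
  mobius_fuel L (#|` fset_set L|)%fset.+1 X.

Definition arr_char_poly (B : set (set V)) : {poly R} :=
  let L := intersection_poset B in
  \sum_(X \in L) ((mobius0 L X)%:~R : R) *: 'X^(affdim X).

Definition complement (B : set (set V)) : set V := ~` \bigcup_(H in B) H.
Definition regions (B : set (set V)) : set (set V) :=
  [set C | exists2 x, complement B x & C = connected_component (complement B) x].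
Definition num_regions_level (B : set (set V)) (k : nat) : nat :=
  (#|` fset_set [set C | regions B C /\ is_level C k]|)%fset.

Definition Bdeform (as_ : 'I_n -> seq R) (bs cs : 'I_n -> 'I_n -> seq R)
  : set (set V) :=
  [set H | (exists i, exists2 a, a \in as_ i & H = [set x : V | x ord0 i = a])
        \/ (exists i j, i != j /\ exists2 b, b \in bs i j &
               H = [set x : V | x ord0 i - x ord0 j = b])
        \/ (exists i j, i != j /\ exists2 c, c \in cs i j &
               H = [set x : V | x ord0 i + x ord0 j = c])].
End Arr.

Definition binom_half (R : realType) (k : nat) : {poly R} :=
  let s := (2%:R)^-1 *: ('X - 1) in
  (k`!%:R)^-1 *: \prod_(i < k) (s - (i%:R)%:P).

(* Main.v *)
(* Fix a direction z and let psi_z be the following function on polyhedra cut out by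
   sign conditions on affine forms: psi_z(P) is, up to the sign given by the dimension of
   P modulo lineality, the indicator of "z lies in the relative interior of the recession
   cone of P".  Refining by one more hyperplane leaves psi_z additive, so the sum of psi_z
   over the cells inside a flat X is 1 if X is parallel to z and 0 otherwise; weighting by
   the Moebius function, the sum of mu(X) over the flats parallel to z is the sum of psi_z
   over the regions.
   Now let p = 2q+1 be an odd prime and sum over z in {-q..q}^n.  A type B flat of
   dimension d contains p^d such points, so the left-hand side is chi(p).  The recession
   cone of a region of level k is a closed k-dimensional face of the type B fan, whose
   relative interior contains binom(q,k) of these points, so the right-hand side is the
   claimed sum at t = p. *)
Require Import Defs.
From HB Require Import structures.
From mathcomp Require Import all_boot all_order all_algebra all_character.
From mathcomp Require Import all_classical all_reals all_analysis.
From mathcomp Require Import finmap.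
From mathcomp Require Import lra ring zify.
Set Implicit Arguments. Unset Strict Implicit. Unset Printing Implicit Defensive.
Import Order.TTheory GRing.Theory Num.Theory.
Import numFieldNormedType.Exports.
Local Open Scope ring_scope.

(** * Annihilators and signs *)

Section Annihilator.
Variables (F : fieldType) (n : nat).
Implicit Types (g : 'cV[F]_n) (s : seq 'cV[F]_n) (v w : 'rV[F]_n).

(** The sign in psi_z(P) is (-1) to the dimension of the recession cone plus the dimension of P. On
    a flat parallel to z both dimensions agree, which gives 1; on a region of level k the sign is
    the (-1)^(n-k) of the formula. A point z of the recession cone is in its relative interior
    exactly when the tangent cone there, cut out by the constraints whose linear part kills z, is a
    linear subspace. In this form both exponents are ranks of annihilators, and adding a hyperplane
    changes each by at most one. Additivity needs the lower-dimensional cells as well, so signs take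
    three values. Flats are counted through 'F_p: their directions solve equations x_i = 0 and x_i =
    x_j or x_i = -x_j, which survive every coordinatewise odd map, and the centred representative
    'F_p -> {-q..q} is odd and injective. Non-degeneracy makes every type B root a normal, so that
    recession cones are faces of the full fan and not of a coarser one. The argument (t-1)/2 of the
    binomials is q at t = p. *)

Definition dot v g : F := (v *m g) ord0 ord0.

Lemma dotD v w g : dot (v + w) g = dot v g + dot w g.
Proof. by rewrite /dot mulmxDl mxE. Qed.

Lemma dotZ a v g : dot (a *: v) g = a * dot v g.
Proof. by rewrite /dot -scalemxAl mxE. Qed.

Lemma dotN v g : dot (- v) g = - dot v g.
Proof. by rewrite /dot mulNmx mxE. Qed.

Lemma dot_eq0 v g : (dot v g == 0) = (v *m g == 0).
Proof.
apply/eqP/eqP => [vg0|]; last by rewrite /dot => ->; rewrite mxE.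
by apply/matrixP => i j; rewrite !ord1 [RHS]mxE.
Qed.

Fixpoint ann s : 'M[F]_n :=
  if s is g :: s' then (ann s' :&: kermx g)%MS else 1%:M.

Lemma sub_ann v s : (v <= ann s)%MS = all (fun g => dot v g == 0) s.
Proof.
elim: s => [|g s IHs] /=; first by rewrite submx1.
by rewrite sub_capmx IHs sub_kermx dot_eq0 andbC.
Qed.

Lemma ann_subset s s' : {subset s <= s'} -> (ann s' <= ann s)%MS.
Proof.
move=> ss'; apply/rV_subP => v; rewrite !sub_ann => /allP vs'.
by apply/allP => g /ss' /vs'.
Qed.

Lemma rank_ann_eq s s' : s =i s' -> \rank (ann s) = \rank (ann s').
Proof.
by move=> ss'; apply/eqP; rewrite eqn_leq !mxrankS // ann_subset // => g;
  rewrite ss'.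
Qed.

Lemma rank_ann_const g s :
  (forall v, (v <= ann s)%MS -> dot v g = 0) ->
  \rank (ann (g :: s)) = \rank (ann s).
Proof.
move=> vg0; apply/eqP; rewrite eqn_leq !mxrankS //= ?capmxSl //.
apply/rV_subP => v vs; rewrite sub_capmx vs sub_kermx -dot_eq0.
by apply/eqP/vg0.
Qed.

Lemma rank_ann_vary g s v :
  (v <= ann s)%MS -> dot v g != 0 ->
  \rank (ann s) = (\rank (ann (g :: s))).+1.
Proof.
move=> vs vg /=; rewrite -[LHS](mxrank_mul_ker _ g) -[RHS]add1n; congr (_ + _)%N.
apply/eqP; rewrite eqn_leq rank_leq_col /= lt0n mxrank_eq0.
apply: contra vg => /eqP sg0; rewrite dot_eq0.
by case/submxP: vs => D ->; rewrite -mulmxA sg0 mulmx0.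
Qed.

End Annihilator.

Section Sign.
Variable R : realFieldType.
Implicit Types (a b x y : R) (s : option bool).

Definition sgo y : option bool := if y == 0 then None else Some (0 < y).

Definition wk s y := (y == 0) || (sgo y == s).

Lemma sgoP y s : reflect
  (match s with Some true => 0 < y | Some false => y < 0 | None => y = 0 end)
  (sgo y == s).
Proof.
apply: (iffP eqP); rewrite /sgo.
  move=> <-; case: eqVneq => // y0; case: ltP => //.
  by rewrite le_eqVlt (negPf y0).
case: s => [[]|] => [y0|y0|->]; last by rewrite eqxx.
  by rewrite gt_eqF// y0.
by rewrite lt_eqF//; congr Some; apply/negbTE; rewrite -leNgt ltW.
Qed.

Lemma wkP y s : reflect
  (match s with Some true => 0 <= y | Some false => y <= 0 | None => y = 0 end)
  (wk s y).
Proof.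
rewrite /wk; apply: (iffP orP).
  by case=> [/eqP->|/sgoP]; case: s => [[]|] // /ltW.
case: s => [[]|] => [|| ->]; last by left.
  rewrite le_eqVlt eq_sym => /orP[->|y0]; [by left|right]; exact/sgoP.
rewrite le_eqVlt => /orP[->|y0]; [by left|right]; exact/sgoP.
Qed.

Lemma sgo_eq0 y : (sgo y == None) = (y == 0).
Proof. by rewrite /sgo; case: (y == 0). Qed.

Lemma sgo_neq0 y : y != 0 -> sgo y != None.
Proof. by rewrite sgo_eq0. Qed.

Lemma wk_sgo y : wk (sgo y) y.
Proof. by rewrite /wk eqxx orbT. Qed.

Lemma wk0 s : wk s 0.
Proof. by rewrite /wk eqxx. Qed.

Lemma sgo_wkD a b : wk (sgo a) b -> sgo (a + b) = sgo a.
Proof.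
move=> ab; apply/eqP/sgoP; move: ab => /wkP.
by case E : (sgo a) => [[]|]; move/eqP/sgoP : E => E H; lra.
Qed.

Lemma wkD s a b : wk s a -> wk s b -> wk s (a + b).
Proof. by move=> /wkP + /wkP + ; case: s => [[]|] A B; apply/wkP; lra. Qed.

Lemma wkZ s a b : 0 <= a -> wk s b -> wk s (a * b).
Proof. by move=> a0 /wkP; case: s => [[]|] B; apply/wkP; nra. Qed.

Lemma wk_pos_comb s a b x y : 0 < a -> 0 < b -> wk s x -> wk s y ->
  a * x + b * y = 0 -> x = 0.
Proof. by move=> a0 b0 /wkP + /wkP +; case: s => [[]|]; nra. Qed.

Lemma sgo_large a b : b != 0 ->
  exists2 m, 0 <= m & forall m', m <= m' -> sgo (a + m' * b) = sgo b.
Proof.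
move=> b0; exists ((`|a| + 1) / `|b|).
  by rewrite divr_ge0 // addr_ge0.
move=> m'; rewrite ler_pdivrMr ?normr_gt0 // => H.
have /andP[a1 a2] : - `|a| <= a <= `|a| by rewrite -ler_norml.
apply/eqP/sgoP; case E : (sgo b) => [[]|]; last first.
- by move/eqP : E; rewrite sgo_eq0 (negPf b0).
- by move/eqP/sgoP : E => E; rewrite (ltr0_norm E) in H; lra.
- by move/eqP/sgoP : E => E; rewrite (gtr0_norm E) in H; lra.
Qed.

Lemma sgo_small a b : a != 0 ->
  exists2 e, 0 < e & forall e', `|e'| <= e -> sgo (a + e' * b) = sgo a.
Proof.
move=> a0; exists (`|a| / (2 * (`|b| + 1))).
  by rewrite divr_gt0 ?normr_gt0 // mulr_gt0 // ltr_wpDl.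
move=> e'; rewrite ler_pdivlMr ?mulr_gt0 // ?ltr_wpDl // => H.
have {}H : `|e' * b| < `|a|.
  rewrite normrM; have := normr_ge0 e'; have := normr_ge0 b.
  have : 0 < `|a| by rewrite normr_gt0.
  nra.
move: H; rewrite ltr_norml => /andP[H1 H2].
apply/eqP/sgoP; case E : (sgo a) => [[]|]; last first.
  by move/eqP : E; rewrite sgo_eq0 (negPf a0).
- move/eqP/sgoP : E => E; rewrite (ltr0_norm E) in H1 H2; lra.
- move/eqP/sgoP : E => E; rewrite (gtr0_norm E) in H1 H2; lra.
Qed.

End Sign.

(** * An additive function on polyhedra *)

Section Valuation.
Variables (R : realFieldType) (n : nat).
Notation form := ('cV[R]_n * R)%type.
Notation constr := (form * option bool)%type.
Implicit Types (h : form) (p : constr) (c : seq constr) (x z u v : 'rV[R]_n).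

Definition ev h x := dot x h.1 - h.2.

Lemma evD h x v : ev h (x + v) = ev h x + dot v h.1.
Proof. by rewrite /ev dotD; ring. Qed.

Definition in_cell c x := all (fun p => sgo (ev p.1 x) == p.2) c.
Definition in_rec c u := all (fun p => wk p.2 (dot u p.1.1)) c.
Definition normals c := [seq p.1.1 | p <- c].
Definition along z c := [seq p <- c | dot z p.1.1 == 0].
Definition tight c := [seq p <- c | p.2 == None].
#[global] Arguments normals : simpl never.
#[global] Arguments along : simpl never.
#[global] Arguments tight : simpl never.
(** The recession cone is a linear space. For z in the recession cone of [c], the recession cone of
    [along z c] is the tangent cone at z, so [lin (along z c)] is the relative interior
    condition. *)
Definition lin c := `[< forall u, in_rec c u -> (u <= ann (normals c))%MS >].
Definition inhab c := `[< exists x, in_cell c x >].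

(* psi_z of the introduction: [in_rec] and [lin] say that z is in the relative interior of
   the recession cone, and the first annihilator is the span of that cone. *)
Definition euler z c : int :=
  if [&& inhab c, in_rec c z & lin (along z c)] then
    (-1) ^+ (\rank (ann (normals (along z c))) + \rank (ann (normals (tight c))))
  else 0.

Lemma all_mem (T : eqType) (P : pred T) (s s' : seq T) :
  s =i s' -> all P s = all P s'.
Proof. by move=> ss'; apply/allP/allP => H y; [rewrite -ss'|rewrite ss']; exact: H. Qed.

Lemma mem_normals c c' : c =i c' -> normals c =i normals c'.
Proof. by move=> cc' g; apply/mapP/mapP => -[p pc ->]; exists p; rewrite // ?cc' // -cc'. Qed.

Lemma in_annP c u :
  reflect (forall p, p \in c -> dot u p.1.1 = 0) (u <= ann (normals c))%MS.
Proof.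
rewrite sub_ann all_map; apply: (iffP allP) => H p pc; first exact/eqP/H.
by apply/eqP/H.
Qed.

Lemma euler_mem z c c' : c =i c' -> euler z c = euler z c'.
Proof.
move=> cc'.
have fcc' (P : pred constr) : [seq p <- c | P p] =i [seq p <- c' | P p] by move=> p; rewrite !mem_filter cc'.
have linE d d' : d =i d' -> lin d = lin d'.
  move=> dd'; apply: asbool_equiv_eq; split=> H u.
    rewrite /in_rec -(all_mem _ dd') => /H /in_annP E.
    by apply/in_annP => p; rewrite -dd'; apply: E.
  rewrite /in_rec (all_mem _ dd') => /H /in_annP E.
  by apply/in_annP => p; rewrite dd'; apply: E.
rewrite /euler /in_rec (all_mem _ cc') (linE (along z c) (along z c')); last exact: fcc'.
rewrite (rank_ann_eq (mem_normals (fcc' (fun p => dot z p.1.1 == 0)))).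
rewrite (rank_ann_eq (mem_normals (fcc' (fun p => p.2 == None)))).
have -> : inhab c = inhab c' => [|//].
by apply: asbool_equiv_eq; split=> -[x xc]; exists x; move: xc;
  rewrite /in_cell (all_mem _ cc').
Qed.

Lemma euler_ninhab z c : inhab c = false -> euler z c = 0.
Proof. by rewrite /euler => ->. Qed.

Lemma inhabW h s c : inhab ((h, s) :: c) -> inhab c.
Proof. by move=> /asboolP[x /= /andP[_ xc]]; apply/asboolP; exists x. Qed.

(** Constraints in [along z c] do not notice the multiple of z; on all others z points strictly to
    the correct side and dominates for large multiples. *)
Lemma in_cell_move c x z u : in_cell c x -> in_rec c z -> in_rec (along z c) u ->
  exists2 m, 0 <= m & forall m', m <= m' -> in_cell c (x + u + m' *: z).
Proof.
elim: c => [|[h s] c IHc] /=; first by exists 0.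
move=> /andP[/eqP xs xc] /andP[zs zc] ucz.
have [m m0 Hm] : exists2 m, 0 <= m & forall m', m <= m' -> in_cell c (x + u + m' *: z).
  by apply: IHc => //; move: ucz; rewrite /along /=; case: ifP => //= _ /andP[].
have [zh0|zh0] := eqVneq (dot z h.1) 0.
  exists m => // m' mm'; rewrite Hm // andbT !evD dotZ zh0 mulr0 addr0.
  rewrite -xs sgo_wkD //; move: ucz; rewrite /along /= zh0 eqxx /= => /andP[].
  by rewrite xs.
have [m1 m10 Hm1] := sgo_large (ev h x + dot u h.1) zh0.
exists (Num.max m m1); first by rewrite le_max m0.
move=> m'; rewrite ge_max => /andP[mm' m1m']; rewrite Hm // andbT.
rewrite !evD dotZ Hm1 //; move: zs; rewrite /wk (negPf zh0) /=.
by move=> /eqP->.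
Qed.

Lemma in_cell_small c x v : in_cell c x -> (v <= ann (normals (tight c)))%MS ->
  exists2 e, 0 < e & forall e', `|e'| <= e -> in_cell c (x + e' *: v).
Proof.
elim: c => [|[h s] c IHc] /=; first by exists 1.
move=> /andP[/eqP xs xc] vc.
have [e e0 He] : exists2 e, 0 < e & forall e', `|e'| <= e -> in_cell c (x + e' *: v).
  apply: IHc => //; apply: submx_trans vc _; apply: ann_subset => g.
  move=> /mapP[p]; rewrite mem_filter => /andP[p0 pc ->].
  by apply/mapP; exists p; rewrite // mem_filter p0 inE pc orbT.
have [x0|x0] := eqVneq (ev h x) 0.
  exists e => // e' ee'; rewrite He // evD dotZ.
  have -> : dot v h.1 = 0.
    move/in_annP : vc => /(_ (h, s)) /= -> //.
    by rewrite mem_filter inE eqxx /= -xs sgo_eq0 x0 eqxx.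
  by rewrite mulr0 addr0 xs eqxx.
have [e1 e10 He1] := sgo_small (dot v h.1) x0.
exists (Num.min e e1); first by rewrite lt_min e0.
by move=> e'; rewrite le_min => /andP[A B]; rewrite He // evD dotZ He1 // xs eqxx.
Qed.

Lemma tight_dir c x y : in_cell c x -> in_cell c y ->
  (x - y <= ann (normals (tight c)))%MS.
Proof.
move=> /allP xc /allP yc; apply/in_annP => p; rewrite mem_filter => /andP[/eqP p0 pc].
have := xc _ pc; have := yc _ pc; rewrite p0 !sgo_eq0 /ev dotD dotN.
by move=> /eqP A /eqP B; lra.
Qed.

Lemma in_cell_mid c x y a b : 0 < a -> 0 < b -> in_cell c x -> in_cell c y ->
  in_cell c ((a / (a + b)) *: x + (b / (a + b)) *: y).
Proof.
move=> a0 b0 /allP xc /allP yc; apply/allP => p pc.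
have ab0 : 0 < a + b by rewrite addr_gt0.
have -> : ev p.1 ((a / (a + b)) *: x + (b / (a + b)) *: y) =
   (a / (a + b)) * ev p.1 x + (b / (a + b)) * ev p.1 y.
  rewrite /ev dotD !dotZ.
  by field; rewrite gt_eqF.
have A : 0 < a / (a + b) by rewrite divr_gt0.
have B : 0 < b / (a + b) by rewrite divr_gt0.
move: (xc _ pc) (yc _ pc) => /sgoP X /sgoP Y; apply/sgoP.
by case: (p.2) X Y => [[]|]; [nra|nra|move=> -> ->; rewrite !mulr0 addr0].
Qed.

(* The values of [h] on a relatively open polyhedron are a point or an open interval. *)
Lemma split_cases h c : inhab c ->
  (forall s, inhab ((h, s) :: c) /\
     exists2 v, (v <= ann (normals (tight c)))%MS & dot v h.1 != 0) \/
  (exists s, [/\ inhab ((h, s) :: c),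
     forall s', inhab ((h, s') :: c) -> s' = s &
     s = None -> forall v, (v <= ann (normals (tight c)))%MS -> dot v h.1 = 0]).
Proof.
move=> /asboolP[x0 x0c].
have vary x v : in_cell c x -> ev h x = 0 -> (v <= ann (normals (tight c)))%MS ->
    dot v h.1 != 0 -> forall s, inhab ((h, s) :: c).
  move=> xc x0' vc vh [b|]; last by apply/asboolP; exists x; rewrite /= xc x0' sgo_eq0 eqxx.
  have [e e0 He] := in_cell_small xc vc.
  have pt t : `|t| = e -> sgo (t * dot v h.1) = Some b -> inhab ((h, Some b) :: c).
    move=> te tb; apply/asboolP; exists (x + t *: v).
    by rewrite /= He ?te // evD x0' add0r dotZ tb eqxx.
  pose t := if b then e else -e.
  have [vh0|vh0|vh0] := ltgtP (dot v h.1) 0; last by rewrite vh0 eqxx in vh.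
    apply: (pt (-t)); rewrite /t.
      by case: (b); rewrite ?opprK ?normrN gtr0_norm.
    by apply/eqP/sgoP; case: (b); nra.
  apply: (pt t); rewrite /t.
    by case: (b); rewrite ?normrN gtr0_norm.
  by apply/eqP/sgoP; case: (b); nra.
have [[v vc vh]|novary] := pselect (exists2 v, (v <= ann (normals (tight c)))%MS & dot v h.1 != 0).
  have [[y yc y0]|nz] := pselect (exists2 y, in_cell c y & ev h y = 0).
    by left=> s; split; [exact: (vary y v)|exists v].
  right; exists (sgo (ev h x0)); split.
  - by apply/asboolP; exists x0; rewrite /= eqxx.
  - move=> s' /asboolP[y /= /andP[/eqP ys yc]].
    rewrite -ys.
    case E : (sgo (ev h x0)) => [b|]; last first.
      by exfalso; apply: nz; exists x0 => //; apply/eqP; rewrite -sgo_eq0 E.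
    case E' : (sgo (ev h y)) => [b'|]; last first.
      by exfalso; apply: nz; exists y => //; apply/eqP; rewrite -sgo_eq0 E'.
    have [->//|bb'] := eqVneq b' b.
    exfalso; apply: nz.
    have X0 : 0 < `|ev h x0| by rewrite normr_gt0 -sgo_eq0 E.
    have Y0 : 0 < `|ev h y| by rewrite normr_gt0 -sgo_eq0 E'.
    (* The point of the segment where h vanishes: with opposite signs at the ends, each end is
       weighted by the absolute value at the other. *)
    exists ((`|ev h y| / (`|ev h y| + `|ev h x0|)) *: x0 +
            (`|ev h x0| / (`|ev h y| + `|ev h x0|)) *: y).
      exact: in_cell_mid.
    have S0 : `|ev h y| + `|ev h x0| != 0 by rewrite gt_eqF // addr_gt0.
    transitivity ((`|ev h y| * ev h x0 + `|ev h x0| * ev h y) / (`|ev h y| + `|ev h x0|)).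
      by rewrite /ev dotD !dotZ; field.
    suff -> : `|ev h y| * ev h x0 + `|ev h x0| * ev h y = 0 by rewrite mul0r.
    move: E E' bb' => /eqP/sgoP + /eqP/sgoP; case: b; case: b' => //= A B _.
      by rewrite (ltr0_norm B) (gtr0_norm A); ring.
    by rewrite (gtr0_norm B) (ltr0_norm A); ring.
  - by move=> /eqP; rewrite sgo_eq0 => /eqP E; exfalso; apply: nz; exists x0.
right; exists (sgo (ev h x0)); split.
- by apply/asboolP; exists x0; rewrite /= eqxx.
- move=> s' /asboolP[y /= /andP[/eqP ys yc]]; rewrite -ys; congr sgo.
  have := tight_dir yc x0c => yx.
  have : dot (y - x0) h.1 = 0.
    by apply/eqP; apply: contra_notT novary => ?; exists (y - x0).
  by rewrite /ev dotD dotN; lra.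
- move=> _ v vc; apply/eqP; apply: contra_notT novary => ?; by exists v.
Qed.

End Valuation.

(** * Additivity under a cut by one hyperplane *)

Section Additivity.
Variables (R : realFieldType) (n : nat).
Notation form := ('cV[R]_n * R)%type.
Notation constr := (form * option bool)%type.
Implicit Types (h : form) (p : constr) (c : seq constr) (x z u v : 'rV[R]_n).

Lemma in_recD c u v : in_rec c u -> in_rec c v -> in_rec c (u + v).
Proof.
move=> /allP uc /allP vc; apply/allP => p pc.
by rewrite dotD wkD ?uc ?vc.
Qed.

Lemma in_recZ c a u : 0 <= a -> in_rec c u -> in_rec c (a *: u).
Proof. by move=> a0 /allP uc; apply/allP => p pc; rewrite dotZ wkZ ?uc. Qed.

Lemma in_rec_ann c u : (u <= ann (normals c))%MS -> in_rec c u.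
Proof. by move=> /in_annP uc; apply/allP => p /uc ->; rewrite wk0. Qed.

Lemma in_rec0 c : in_rec c 0.
Proof. by apply/in_rec_ann/sub0mx. Qed.

(** A long way along u decides the side of h; a longer way along z then repairs the constraints
    violated by u and, being parallel to h, does not change that side. *)
Lemma inhab_rec z h c u : inhab c -> in_rec c z -> dot z h.1 = 0 ->
  in_rec (along z c) u -> dot u h.1 != 0 -> inhab ((h, sgo (dot u h.1)) :: c).
Proof.
move=> /asboolP[x xc] zc zh uc uh.
have [a a0 Ha] := sgo_large (ev h x) uh.
have [m m0 Hm] := in_cell_move xc zc (in_recZ a0 uc).
apply/asboolP; exists (x + a *: u + m *: z); rewrite /= Hm // andbT.
by rewrite !evD !dotZ zh mulr0 addr0 Ha.
Qed.

(** Only the piece towards which z points keeps z as a recession direction. It is reached by going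
    far along z, and neither exponent sees the new constraint. *)
Lemma euler_split_transverse z h c : dot z h.1 != 0 ->
  forall s, euler z ((h, s) :: c) = if s == sgo (dot z h.1) then euler z c else 0.
Proof.
move=> zh s; rewrite /euler [in_rec _ _]/= {1}/wk (negPf zh) /= eq_sym.
have [->|_] := eqVneq; last by rewrite andbF.
have -> s' : along z ((h, s') :: c) = along z c by rewrite /along /= (negPf zh).
rewrite {1}/tight /= (negPf (sgo_neq0 zh)) -/(tight c) -/(in_rec c z).
case zc : (in_rec c z); rewrite ?andbF //=.
suff -> : inhab ((h, sgo (dot z h.1)) :: c) = inhab c by [].
apply/idP/idP => [/inhabW//|/asboolP[x xc]].
have [m m0 Hm] := in_cell_move xc zc (in_rec0 _).
have [m' m'0 Hm'] := sgo_large (ev h x) zh.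
apply/asboolP; exists (x + 0 + (Num.max m m') *: z).
rewrite /= Hm ?le_max ?lexx // andbT addr0 evD dotZ Hm' ?eqxx //.
by rewrite le_max lexx orbT.
Qed.

Lemma linP c : reflect (forall u, in_rec c u -> (u <= ann (normals c))%MS) (lin c).
Proof. exact: asboolP. Qed.

Lemma in_ann_cons h s c u :
  (u <= ann (normals ((h, s) :: c)))%MS = (dot u h.1 == 0) && (u <= ann (normals c))%MS.
Proof. by rewrite !sub_ann. Qed.

Lemma in_rec_cons h s c u :
  in_rec ((h, s) :: c) u = wk s (dot u h.1) && in_rec c u.
Proof. by []. Qed.

Lemma euler_split z h c :
  euler z c = euler z ((h, Some true) :: c) + euler z ((h, None) :: c)
          + euler z ((h, Some false) :: c).
Proof.
case xc : (inhab c); last first.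
  have nc s : inhab ((h, s) :: c) = false.
    by apply/negP => /inhabW; rewrite xc.
  by rewrite !euler_ninhab ?addr0.
have [zh|zh] := eqVneq (dot z h.1) 0; last first.
  rewrite !euler_split_transverse //.
  by case: (sgo (dot z h.1)) (sgo_neq0 zh) => [[]|//] _ /=; rewrite ?addr0 ?add0r.
case zc : (in_rec c z); last by rewrite /euler /= zc !andbF !addr0.
pose K := along z c; pose T := tight c.
have valE s : euler z ((h, s) :: c) = if inhab ((h, s) :: c) && lin ((h, s) :: K) then
   (-1) ^+ (\rank (ann (h.1 :: normals K)) +
      \rank (ann (if s == None then h.1 :: normals T else normals T))) else 0.
  rewrite /euler in_rec_cons zc zh wk0 /= /along /= zh eqxx /tight /=.
  by case: (s == None).
have valcE : euler z c = if lin K then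
    (-1) ^+ (\rank (ann (normals K)) + \rank (ann (normals T))) else 0.
  by rewrite /euler xc zc.
have KT u : (u <= ann (normals K))%MS -> (u <= ann (normals T))%MS.
  move=> /in_annP uK; apply/in_annP => p; rewrite mem_filter => /andP[/eqP p0 pc].
  apply: uK; rewrite mem_filter pc andbT.
  by move/allP : zc => /(_ _ pc); rewrite p0 => /wkP ->.
(* If h varies on the lineality space of the tangent cone, the two open pieces get a cone that
   contains u0 or -u0 but not both, so they contribute 0. The middle piece loses one in both
   exponents, so its sign is that of [c]. *)
have [[u0 u0K u0h]|Kconst] := pselect (exists2 u, (u <= ann (normals K))%MS & dot u h.1 != 0).
  have nlin b : lin ((h, Some b) :: K) = false.
    apply/negP => /linP H.
    have rec_u0 t : in_rec K (t *: u0) by rewrite in_rec_ann // scalemx_sub.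
    pose t := if b == (0 < dot u0 h.1) then 1 else - 1 : R.
    have th : 0 != t * dot u0 h.1.
      by rewrite eq_sym mulf_neq0 // /t; case: ifP; rewrite ?oppr_eq0 oner_eq0.
    have := H (t *: u0); rewrite in_rec_cons rec_u0 in_ann_cons dotZ [_ == 0]eq_sym.
    rewrite (negPf th) andbT /= => W; suff : false by []; apply: W.
    apply/wkP; rewrite /t; have [A|A|A] := ltgtP (dot u0 h.1) 0.
    - by case: (b); rewrite /=; lra.
    - by case: (b); rewrite /=; lra.
    - by rewrite A eqxx in u0h.
  rewrite !valE !nlin !andbF add0r addr0 valcE.
  rewrite (rank_ann_vary u0K u0h) (rank_ann_vary (KT _ u0K) u0h) /=.
  rewrite addSn addnS !exprS !mulN1r opprK.
  suff -> : lin K = inhab ((h, None) :: c) && lin ((h, None) :: K) by [].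
  apply/idP/andP => [linK|[_ /linP lin0]].
    split.
      (* If a single sign were realised, u0 and -u0 would both have to point to that side of h. *)
      case: (split_cases h xc) => [H|[s [_ us _]]]; first by have [] := H None.
      have sg t : t != 0 -> sgo (t * dot u0 h.1) = s.
        move=> t0; apply: us; rewrite -dotZ.
        apply: (inhab_rec xc zc zh); first by rewrite in_rec_ann // scalemx_sub.
        by rewrite dotZ mulf_neq0.
      have /eqP := sg 1 (oner_neq0 _); have := sg (-1).
      rewrite oppr_eq0 oner_eq0 => /(_ isT)/eqP.
      rewrite mulN1r mul1r => /sgoP + /sgoP.
      by case: (s) => [[]|]; [lra|lra|move=> _ E; rewrite E eqxx in u0h].
    apply/linP => u; rewrite in_rec_cons in_ann_cons => /andP[/wkP-> uK].
    by rewrite eqxx; move/linP : linK; apply.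
  (* Subtracting this multiple of u0 projects u into h = 0, where the hypothesis on the middle piece
     applies. *)
  apply/linP => u uK; pose a := dot u h.1 / dot u0 h.1.
  have au0 b : (b *: u0 <= ann (normals K))%MS by rewrite scalemx_sub.
  have recu : in_rec ((h, None) :: K) (u + - a *: u0).
    rewrite in_rec_cons in_recD ?(in_rec_ann (au0 _)) // andbT.
    by apply/wkP; rewrite dotD dotZ /a; field.
  have := lin0 _ recu; rewrite in_ann_cons => /andP[_ H].
  have -> : u = (u + - a *: u0) + a *: u0 by rewrite scaleNr addrNK.
  exact: addmx_sub.
(* From here on h vanishes on the lineality space, so the first exponent never changes. The facts
   below amount to: the indicator of [lin K] is the sum of those of the two open pieces minus that
   of the middle one. *)
have {}Kconst u : (u <= ann (normals K))%MS -> dot u h.1 = 0.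
  by move=> uK; apply/eqP; apply: contra_notT Kconst => ?; exists u.
rewrite !valE valcE (rank_ann_const Kconst) /=.
have linsP s : reflect (forall u, in_rec K u -> wk s (dot u h.1) ->
    (u <= ann (normals K))%MS) (lin ((h, s) :: K)).
  apply: (iffP (linP _)) => [H u uK us|H u].
    by move: (H u); rewrite in_rec_cons in_ann_cons us uK => /(_ isT)/andP[].
  rewrite in_rec_cons in_ann_cons => /andP[us uK].
  by rewrite (H u uK us) Kconst ?eqxx // H.
have linW s : lin K -> lin ((h, s) :: K).
  by move=> /linP H; apply/linsP => u uK _; apply: H.
have lin0 b : lin ((h, Some b) :: K) -> lin ((h, None) :: K).
  by move=> /linsP H; apply/linsP => u uK /wkP u0; apply: H => //; rewrite u0 wk0.
have lin2 : lin ((h, Some true) :: K) -> lin ((h, Some false) :: K) -> lin K.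
  move=> /linsP H /linsP H'; apply/linP => u uK.
  have [uh|uh] := leP 0 (dot u h.1); first by apply: H => //; apply/wkP.
  by apply: H' => //; apply/wkP/ltW.
(* Otherwise there are directions u and w strictly on the two sides of h. A positive combination
   lies in h = 0, hence in the lineality space, and since no constraint allows cancellation, u lies
   there too. *)
have lin1 : lin ((h, None) :: K) -> lin ((h, Some true) :: K) || lin ((h, Some false) :: K).
  move=> /linsP H0; apply/orP; apply: contrapT => /not_orP[N N'].
  have [u [uK uh uN]] : exists u, [/\ in_rec K u, 0 < dot u h.1 & ~ (u <= ann (normals K))%MS].
    apply: contrapT => NN; apply: N; apply/linsP => u uK /wkP.
    rewrite le_eqVlt => /orP[/eqP e|e]; first by apply: H0 => //; rewrite -e wk0.
    by apply: contrapT => ?; apply: NN; exists u.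
  have [w [wK wh _]] : exists u, [/\ in_rec K u, dot u h.1 < 0 & ~ (u <= ann (normals K))%MS].
    apply: contrapT => NN; apply: N'; apply/linsP => w wK /wkP.
    rewrite le_eqVlt => /orP[/eqP e|e]; first by apply: H0 => //; rewrite e wk0.
    by apply: contrapT => ?; apply: NN; exists w.
  apply: uN.
  have W : 0 < - dot w h.1 by rewrite oppr_gt0.
  have : ((- dot w h.1 *: u + dot u h.1 *: w)%R <= ann (normals K))%MS.
    apply: H0; first by rewrite in_recD // in_recZ // ltW.
    by apply/wkP; rewrite dotD !dotZ; ring.
  move=> /in_annP H; apply/in_annP => p pK; have := H _ pK.
  by rewrite dotD !dotZ => /(wk_pos_comb W uh (allP uK _ pK) (allP wK _ pK)).
(* With all three pieces present, the middle one has one dimension less and thus the opposite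
   sign. *)
case: (split_cases h xc) => [all_s|[s [sc us s0]]].
  have [_ [v vT vh]] := all_s None.
  rewrite !(all_s _).1 /= (rank_ann_vary vT vh) addnS exprS mulN1r.
  set e := (-1) ^+ _.
  case lK : (lin K); first by rewrite !(linW _ lK) addNr add0r.
  case lp : (lin ((h, Some true) :: K)); case ln : (lin ((h, Some false) :: K)).
  - by rewrite (lin2 lp ln) in lK.
  - by rewrite (lin0 _ lp) addNr addr0.
  - by rewrite (lin0 _ ln) add0r addrN.
  - by case l0 : (lin _); rewrite ?addr0 //; move: (lin1 l0); rewrite lp ln.
(* With a single piece present, [inhab_rec] forces every direction of the tangent cone weakly to its
   side, so the new constraint is redundant. *)
have -> : lin K = lin ((h, s) :: K).
  apply/idP/idP => [/linW//|/linsP H]; apply/linP => u uK; apply: H => //.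
  have [->|uh] := eqVneq (dot u h.1) 0; first by rewrite wk0.
  by rewrite -(us _ (inhab_rec xc zc zh uK uh)) wk_sgo.
have nin s' : s' != s -> inhab ((h, s') :: c) = false.
  by move=> /eqP ss'; apply/negP => /us.
case: s sc us s0 nin => [[]|] sc us s0 nin; rewrite sc !nin //= ?addr0 ?add0r //.
by rewrite (rank_ann_const (s0 erefl)).
Qed.

End Additivity.

(** * Sums over cells *)

Section Cells.
Variables (R : realFieldType) (n : nat).
Notation form := ('cV[R]_n * R)%type.
Notation constr := (form * option bool)%type.
Implicit Types (h : form) (p : constr) (c : seq constr) (x z u v : 'rV[R]_n).
Implicit Types (l S : seq form) (sg : seq (option bool)).

Fixpoint signs m : seq (seq (option bool)) :=
  if m is m'.+1 then
    [seq s :: sg | s <- [:: Some true; None; Some false], sg <- signs m']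
  else [:: [::]].

Lemma mem_signs m sg : (sg \in signs m) = (size sg == m).
Proof.
elim: m sg => [|m IHm] sg; first by rewrite inE; case: sg.
apply/idP/idP => [|]; first by move=> /allpairsPdep[s [sg' [_]]]; rewrite IHm => /eqP <- ->.
case: sg => // s sg; rewrite eqSS -IHm => sgm; apply/allpairsPdep.
by exists s, sg; split=> //; rewrite !inE; case: s => [[]|].
Qed.

Lemma uniq_signs m : uniq (signs m).
Proof.
elim: m => //= m IHm; rewrite -/(allpairs _ _ _).
by apply: (allpairs_uniq (s := [:: _; _; _])) => // -[a b] [a' b'] _ _ /= [-> ->].
Qed.

Lemma sum_euler z l c :
  \sum_(sg <- signs (size l)) euler z (zip l sg ++ c) = euler z c.
Proof.
elim: l c => [|h l IHl] c; first by rewrite big_seq1.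
rewrite big_allpairs_dep exchange_big -[RHS]IHl /=; apply: eq_bigr => sg _.
by rewrite !big_cons big_nil /= addr0 addrA -euler_split.
Qed.

Lemma mem_zip l sg h : size sg = size l -> h \in l -> exists s, (h, s) \in zip l sg.
Proof.
move=> szsg hl; exists (nth None sg (index h l)).
have := nth_zip h None (index h l) (esym szsg); rewrite nth_index // => <-.
by rewrite mem_nth // size_zip szsg minnn index_mem.
Qed.

Definition on_cell l sg S := all (fun h => (h, None) \in zip l sg) S.

Definition lies_on S : seq constr := [seq (h, None) | h <- S].

(** The equations of the flat either repeat signs already prescribed or contradict one of them, and
    then the cell is empty. *)
Lemma euler_on_flat z l sg S : size sg = size l -> {subset S <= l} ->
  euler z (zip l sg ++ lies_on S) = if on_cell l sg S then euler z (zip l sg) else 0.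
Proof.
move=> szsg Sl; case: ifP => [/allP H|/negP H].
  apply: euler_mem => p; rewrite mem_cat; apply/orP/idP => [[//|/mapP[h hS ->]]|]; last by left.
  exact: H.
apply: euler_ninhab; apply/negP => /asboolP[x]; rewrite /in_cell all_cat.
move=> /andP[/allP xl /allP xS]; apply: H; apply/allP => h hS.
have [s hs] := mem_zip szsg (Sl _ hS).
have /eqP <- : sgo (ev h x) == None by apply: (xS (h, None)); apply: map_f.
by rewrite (eqP (xl _ hs)).
Qed.

(** All constraints are equations, so the recession cone is linear and both exponents equal its
    dimension. *)
Lemma euler_flat z S : inhab (lies_on S) ->
  euler z (lies_on S) = (z <= ann (map fst S))%MS%:R.
Proof.
move=> Sx; rewrite /euler Sx /=.
have normS : normals (lies_on S) = map fst S by rewrite /normals -map_comp.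
have recE c : {subset c <= lies_on S} ->
    forall u, in_rec c u = (u <= ann (normals c))%MS.
  move=> cS u; apply/allP/in_annP => H p pc; have := H p pc.
    by case/cS/mapP: pc => h hS -> /wkP.
  by move=> ->; rewrite wk0.
rewrite recE // normS; case: (boolP (_ <= _)%MS) => // zS /=.
have -> : along z (lies_on S) = lies_on S.
  apply/all_filterP/allP => p pS; move: zS; rewrite -normS => /in_annP/(_ _ pS) ->.
  by rewrite eqxx.
have -> : tight (lies_on S) = lies_on S.
  by apply/all_filterP/allP => p /mapP[h _ ->].
rewrite (_ : lin _); last by apply/linP => u; rewrite recE.
by rewrite addnn -signr_odd odd_double.
Qed.

Lemma sum_euler_flat z l S : {subset S <= l} -> inhab (lies_on S) ->
  \sum_(sg <- signs (size l) | on_cell l sg S) euler z (zip l sg)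
  = (z <= ann (map fst S))%MS%:R.
Proof.
move=> Sl Sx; rewrite -euler_flat // -[RHS](sum_euler z l) big_mkcond /=.
rewrite !big_seq; apply: eq_bigr => sg; rewrite mem_signs => /eqP szsg.
by rewrite euler_on_flat.
Qed.

Definition face_dir c v := in_rec c v && lin (along v c).

Lemma face_dir_exists c : exists v, face_dir c v.
Proof.
(* It is enough that v kills only the normals that vanish on the whole cone: for a tangent vector u,
   some u + m v lies in the cone, so these normals vanish on u. *)
suff [v vc v0] : exists2 v, in_rec c v & forall p, p \in c -> dot v p.1.1 = 0 ->
    forall u, in_rec c u -> dot u p.1.1 = 0.
  exists v; rewrite /face_dir vc; apply/linP => u uv; apply/in_annP => p.
  rewrite mem_filter => /andP[/eqP vp pc].
  have [m Hm] : exists m, in_rec c (u + m *: v).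
    suff [m _ Hm] : exists2 m, 0 <= m & forall m', m <= m' -> in_rec c (u + m' *: v).
      by exists m; apply: Hm.
    move: vc uv {vp pc v0}; elim: c {p} => [|[h s] c IHc] /=; first by exists 0.
    move=> /andP[vs vc] uv.
    have {IHc}[|m m0 Hm] := IHc vc.
      by move: uv; rewrite /along /=; case: ifP => //= _ /andP[].
    have [vh|vh] := eqVneq (dot v h.1) 0.
      exists m => // m' mm'; rewrite Hm // andbT dotD dotZ vh mulr0 addr0.
      by move: uv; rewrite /along /= vh eqxx /= => /andP[].
    have [m1 m10 Hm1] := sgo_large (dot u h.1) vh.
    exists (Num.max m m1); first by rewrite le_max m0.
    move=> m'; rewrite ge_max => /andP[mm' m1m']; rewrite Hm // andbT dotD dotZ /wk Hm1 //.
    by move: vs; rewrite /wk (negPf vh) /= => ->; rewrite orbT.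
  by have := v0 p pc vp _ Hm; rewrite dotD dotZ vp mulr0 addr0.
suff H (d : seq constr) : {subset d <= c} -> exists2 v, in_rec c v & forall p, p \in d ->
    dot v p.1.1 = 0 -> forall u, in_rec c u -> dot u p.1.1 = 0 by exact: H.
elim: d => [|q d IHd] dc; first by exists 0; [exact: in_rec0|].
have [|v vc v0] := IHd; first by move=> p pd; rewrite dc // inE pd orbT.
have [[w wc wq]|nw] := pselect (exists2 w, in_rec c w & dot w q.1.1 != 0).
  have vw p : p \in c -> dot (v + w) p.1.1 = 0 -> dot v p.1.1 = 0.
    move=> pc; rewrite dotD -[dot v _]mul1r -[dot w _]mul1r.
    move/(wk_pos_comb ltr01 ltr01 (allP vc _ pc) (allP wc _ pc)) => ->.
    by rewrite mul1r.
  (* The sum is nonzero wherever v or w is, because both satisfy the same weak sign condition and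
     cannot cancel. *)
  exists (v + w); first exact: in_recD.
  move=> p; rewrite inE => /predU1P[->|pd] vwp.
    have := vw q (dc _ (mem_head _ _)) vwp; move: vwp; rewrite dotD => + E.
    by rewrite E add0r => /eqP; rewrite (negPf wq).
  by apply: v0 => //; apply: vw => //; rewrite dc // inE pd orbT.
exists v => // p; rewrite inE => /predU1P[->|pd]; last exact: v0.
by move=> _ u uc; apply/eqP; apply: contra_notT nw => ?; exists u.
Qed.

Lemma face_dir_sgo c v z : face_dir c v -> face_dir c z ->
  all (fun p => sgo (dot z p.1.1) == sgo (dot v p.1.1)) c.
Proof.
move=> /andP[vc /linP vl] /andP[zc /linP zl].
have sub_rec y w : in_rec c w -> in_rec (along y c) w.
  by move=> /allP wc; apply/allP => p; rewrite mem_filter => /andP[_ /wc].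
apply/allP => p pc.
have zero y w : in_rec c w -> (forall u, in_rec (along y c) u ->
    (u <= ann (normals (along y c)))%MS) -> dot y p.1.1 = 0 -> dot w p.1.1 = 0.
  move=> wc yl yp; have /in_annP := yl _ (sub_rec y _ wc); apply.
  by rewrite mem_filter yp eqxx.
have [vp|vp] := eqVneq (dot v p.1.1) 0; first by rewrite (zero v z) // vp.
have zp : dot z p.1.1 != 0 by apply: contraNneq vp => /(zero z v) ->.
move: (allP vc _ pc) (allP zc _ pc).
by rewrite /wk (negPf vp) (negPf zp) => /eqP-> /eqP->.
Qed.

(** This identifies the relative interior of the recession cone with one face of the central
    arrangement of the normals, the one that contains v. *)
Lemma face_dir_eq c v z : face_dir c v ->
  face_dir c z = all (fun p => sgo (dot z p.1.1) == sgo (dot v p.1.1)) c.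
Proof.
move=> cv; apply/idP/idP => [|/allP zv]; first exact: face_dir_sgo.
have z0 p : p \in c -> (dot z p.1.1 == 0) = (dot v p.1.1 == 0).
  by move=> pc; rewrite -!sgo_eq0 (eqP (zv _ pc)).
move: cv; rewrite /face_dir /along (eq_in_filter z0) => /andP[/allP vc ->].
rewrite andbT; apply/allP => p pc; have := vc _ pc.
by rewrite /wk z0 // (eqP (zv _ pc)).
Qed.

Definition face_rank c v := \rank (ann (normals (along v c))).

Lemma euler_region z c v : inhab c -> all (fun p => p.2 != None) c -> face_dir c v ->
  euler z c = if all (fun p => sgo (dot z p.1.1) == sgo (dot v p.1.1)) c
    then (-1) ^+ (face_rank c v + n) else 0.
Proof.
move=> xc c0 cv; rewrite -(face_dir_eq z cv) /euler xc /=.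
have -> : tight c = [::].
  by apply/eqP; rewrite -(negbK (_ == _)) -has_filter -all_predC; apply: sub_all c0.
rewrite -/(face_dir c z) /= mxrank1; case: ifP => // cz.
congr ((-1) ^+ (_ + _)); rewrite /face_rank /along; congr (\rank (ann (normals _))).
apply: eq_in_filter => p pc.
by rewrite -!sgo_eq0 (eqP (allP (face_dir_sgo cv cz) _ pc)).
Qed.

End Cells.

(** * Lattice points of type B flats *)

(* [(i, None)] encodes x_i, [(i, Some (false, j))] encodes x_i + x_j and
   [(i, Some (true, j))] encodes x_i - x_j. *)
Notation broot n := ('I_n * option (bool * 'I_n))%type.

Section Roots.
Variable n : nat.
Implicit Types r : broot n.

Definition reval (M : zmodType) (z : 'I_n -> M) r : M :=
  z r.1 + (if r.2 is Some (b, j) then if b then - z j else z j else 0).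

Definition rvec (F : pzRingType) r : 'cV[F]_n :=
  delta_mx r.1 ord0 +
  (if r.2 is Some (b, j) then if b then - delta_mx j ord0 else delta_mx j ord0 else 0).

Lemma dot_rvec (F : fieldType) (v : 'rV[F]_n) r : dot v (rvec F r) = reval (v ord0) r.
Proof.
rewrite /dot /rvec /reval mulmxDr mxE -colE mxE.
by case: r.2 => [[[] j]|]; rewrite ?mulmxN ?mulmx0 -?colE !mxE.
Qed.

Definition odd_fun (M N : zmodType) (f : M -> N) := forall x, f (- x) = - f x.

(** Type B equations only say that entries are zero, equal or opposite. The value at 0 is a separate
    hypothesis since oddness does not fix it in the presence of 2-torsion. *)
Lemma reval_odd0 (M N : zmodType) (f : M -> N) (z : 'I_n -> M) r :
  odd_fun f -> f 0 = 0 -> reval z r = 0 -> reval (f \o z) r = 0.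
Proof.
move=> fN f0; rewrite /reval /=; case: r.2 => [[[] j]|].
- by move=> /subr0_eq ->; rewrite subrr.
- by move=> /eqP; rewrite addr_eq0 => /eqP ->; rewrite fN addNr.
- by rewrite !addr0 => ->.
Qed.

Lemma reval_odd_inj (M N : zmodType) (f : M -> N) (z : 'I_n -> M) r :
  odd_fun f -> f 0 = 0 -> injective f ->
  (reval (f \o z) r == 0) = (reval z r == 0).
Proof.
move=> fN f0 fI; apply/eqP/eqP => [|]; last exact: reval_odd0.
rewrite /reval /=; case: r.2 => [[[] j]|].
- by move=> /subr0_eq /fI ->; rewrite subrr.
- by move=> /eqP; rewrite addr_eq0 -fN => /eqP /fI ->; rewrite addNr.
- by rewrite !addr0 -[X in _ = X]f0 => /fI.
Qed.

Definition rann (F : fieldType) (s : seq (broot n)) := ann (map (rvec F) s).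

Lemma rannP (F : fieldType) s (v : 'rV[F]_n) :
  reflect (forall r, r \in s -> reval (v ord0) r = 0) (v <= rann F s)%MS.
Proof.
rewrite sub_ann all_map; apply: (iffP allP) => H r rs; have := H r rs; rewrite /= dot_rvec.
  by move/eqP.
by move=> ->.
Qed.

Section Threshold.
Variables (R : realFieldType) (F : fieldType).

(** An odd map from the ordered field to any field: it carries real solutions of type B equations to
    solutions over 'F_p. *)
Definition threshold (m x : R) : F := if m < x then 1 else if m < - x then -1 else 0.

Lemma threshold_odd m : 0 <= m -> odd_fun (threshold m).
Proof.
move=> m0 x; rewrite /threshold opprK.
have [mx|mx] := ltP m x; have [mx'|mx'] := ltP m (- x); rewrite ?opprK ?oppr0 //.
by exfalso; lra.
Qed.

Lemma threshold0 m : 0 <= m -> threshold m 0 = 0.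
Proof. by move=> m0; rewrite /threshold oppr0 ltNge m0. Qed.

Lemma threshold_neq0 m x : m < `|x| -> threshold m x != 0.
Proof.
rewrite /threshold; have [x0|x0] := ltP 0 x.
  by rewrite gtr0_norm // => ->; rewrite oner_eq0.
rewrite ler0_norm // => ->; case: ifP; rewrite ?oppr_eq0 oner_eq0 //.
Qed.

Lemma threshold_norm x : threshold `|x| x = 0.
Proof.
rewrite /threshold [_ < x]ltNge ler_norm /=.
by rewrite -normrN ltNge ler_norm.
Qed.

(** A level between the two absolute values kills exactly one summand. If they agree then x = y, and
    the sum is 2 or -2, which is where odd characteristic matters. *)
Lemma threshold_sep x y : (2%:R : F) != 0 -> x + y != 0 ->
  exists2 m, 0 <= m & threshold m x + threshold m y != 0.
Proof.
move=> F2 xy; have [xy'|xy'|xy'] := ltgtP `|x| `|y|.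
- by exists `|x|; rewrite // threshold_norm add0r threshold_neq0.
- by exists `|y|; rewrite // threshold_norm addr0 threshold_neq0.
exists 0 => //; have yx : y = x.
  move/eqP: xy'; rewrite eqr_norm2 => /orP[/eqP//|/eqP E].
  by rewrite E addNr eqxx in xy.
subst y; have x0 : x != 0 by apply: contraNneq xy => ->; rewrite addr0.
rewrite /threshold oppr_gt0; have [_|x1|E] := ltgtP 0 x; last by rewrite E eqxx in x0.
  by rewrite -[1 + 1]/(2%:R).
by rewrite -opprD oppr_eq0 -[1 + 1]/(2%:R).
Qed.

Lemma reval_threshold (z : 'I_n -> R) r : (2%:R : F) != 0 -> reval z r != 0 ->
  exists2 m, 0 <= m & reval (threshold m \o z) r != 0.
Proof.
move=> F2; rewrite /reval; case: r.2 => [[[] j]|] /=.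
- move=> /(threshold_sep F2)[m m0 H]; exists m => //.
  by rewrite -threshold_odd.
- exact: threshold_sep.
rewrite addr0 => H; exists 0 => //=.
by rewrite addr0 threshold_neq0 // normr_gt0.
Qed.

End Threshold.

(** * The box {-q..q}^n as the vector space 'F_p^n *)

Section BoxPoints.
Variables (R : realFieldType) (p q : nat).
Hypotheses (p_pr : prime p) (pq : p = q.*2.+1).

(** The representative of [a] in {-q..q}, centred so as to be odd. *)
Definition srep (a : 'F_p) : R :=
  if (nat_of_ord a <= q)%N then (nat_of_ord a)%:R else (nat_of_ord a)%:R - p%:R.

Definition sabs (a : 'F_p) : nat := if (nat_of_ord a <= q)%N then nat_of_ord a else (p - nat_of_ord a)%N.

Lemma val_ltp (a : 'F_p) : (nat_of_ord a < p)%N.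
Proof. by have := ltn_ord a; rewrite [X in (_ < X)%N](Fp_cast p_pr). Qed.

Lemma sabs_le a : (sabs a <= q)%N.
Proof. by rewrite /sabs; have := val_ltp a; case: ifP => //; lia. Qed.

Lemma srepE a : srep a = (sabs a)%:R /\ a = (sabs a)%:R \/
  srep a = - (sabs a)%:R /\ a = - (sabs a)%:R.
Proof.
rewrite /srep /sabs; case: ifP => _; [left|right]; split=> //.
- by rewrite natr_Zp.
- by rewrite natrB ?opprB // ltnW // val_ltp.
- rewrite natrB ?natr_Zp ?(ltnW (val_ltp a)) //.
  by rewrite -(Fp_nat_mod p_pr p) modnn sub0r opprK.
Qed.

Lemma srep_nat m : (m <= q)%N -> srep m%:R = m%:R.
Proof. by move=> mq; rewrite /srep val_Fp_nat // modn_small ?mq //; lia. Qed.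

Lemma srepN : odd_fun srep.
Proof.
have srepNn m : (m <= q)%N -> srep (- m%:R) = - m%:R.
  case: m => [|m] mq; first by rewrite !oppr0 -[0]/(0%:R) srep_nat.
  have -> : - m.+1%:R = (p - m.+1)%:R :> 'F_p.
    by rewrite natrB ?(Fp_nat_mod p_pr) -?(Fp_nat_mod p_pr p) ?modnn ?sub0r //; lia.
  rewrite /srep val_Fp_nat // modn_small; last by lia.
  rewrite ifF; last by lia.
  have mp : (m.+1 <= p)%N by lia.
  by rewrite (natrB _ mp) addrAC subrr sub0r.
move=> a; case: (srepE a) => -[-> {1}->]; first by rewrite srepNn ?sabs_le.
by rewrite !opprK srep_nat ?sabs_le.
Qed.

Lemma srep0 : srep 0 = 0.
Proof. by rewrite -[0]/(0%:R) srep_nat. Qed.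

Lemma srep_inj : injective srep.
Proof.
move=> a b; case: (srepE a) => -[-> {2}->]; case: (srepE b) => -[-> {2}->].
- by move=> /eqP; rewrite eqr_nat => /eqP->.
- by move=> /eqP; rewrite -addr_eq0 -natrD pnatr_eq0 addn_eq0 => /andP[/eqP-> /eqP->];
  rewrite oppr0.
- by move=> /eqP; rewrite eq_sym -addr_eq0 -natrD pnatr_eq0 addn_eq0 => /andP[/eqP-> /eqP->];
  rewrite oppr0.
- by move=> /eqP; rewrite eqr_opp eqr_nat => /eqP->.
Qed.

Lemma Fp2_neq0 : (2%:R : 'F_p) != 0.
Proof.
apply/eqP => /(congr1 (@nat_of_ord _)); rewrite val_Fp_nat //.
by have := prime_gt1 p_pr => p1; rewrite modn_small //; lia.
Qed.

Definition rlift (z : 'rV['F_p]_n) : 'rV[R]_n := map_mx srep z.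

Lemma reval_ext (M : zmodType) (f g : 'I_n -> M) r : f =1 g -> reval f r = reval g r.
Proof. by move=> fg; rewrite /reval !fg; case: r.2 => [[b j]|] //; rewrite fg. Qed.

Lemma rlift_rann s z : (rlift z <= rann R s)%MS = (z <= rann _ s)%MS.
Proof.
have E r : (reval (rlift z ord0) r == 0) = (reval (z ord0) r == 0).
  rewrite -(@reval_odd_inj _ _ srep (z ord0) r srepN srep0 srep_inj).
  by congr (_ == 0); apply: reval_ext => i; rewrite mxE.
by apply/rannP/rannP => H r /H/eqP; [rewrite E|rewrite -E] => /eqP.
Qed.

(* Type B flats are stable under coordinatewise odd functions, so that the rank
   can be read off over 'F_p. *)
Lemma rank_rann s : \rank (rann R s) = \rank (rann 'F_p s).
Proof.
elim: s => [|r s IHs]; first by rewrite !mxrank1.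
have [[v vs vr]|nv] :=
    pselect (exists2 v : 'rV[R]_n, (v <= rann R s)%MS & reval (v ord0) r != 0).
  (* The vector v shows that r lowers the dimension over R; thresholding its entries gives such a
     witness over 'F_p. In the other case a witness over 'F_p would lift to R by [srep]. *)
  have [m m0 mr] := reval_threshold Fp2_neq0 vr.
  pose w : 'rV['F_p]_n := map_mx (threshold _ m) v.
  have wE r' : reval (w ord0) r' = reval (threshold _ m \o v ord0) r'.
    by apply: reval_ext => i; rewrite mxE.
  have ws : (w <= rann _ s)%MS.
    apply/rannP => r' r's; rewrite wE.
    apply: reval_odd0; [exact: threshold_odd|exact: threshold0|].
    by move/rannP : vs; apply.
  apply/eqP; rewrite -eqSS; apply/eqP.
  rewrite -(rank_ann_vary vs (g := rvec R r)) ?dot_rvec //.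
  by rewrite -(rank_ann_vary ws (g := rvec _ r)) ?dot_rvec // wE.
rewrite [LHS]rank_ann_const ?[RHS]rank_ann_const // => v vs; rewrite dot_rvec.
  move: vs; rewrite -rlift_rann => vs.
  apply/eqP; rewrite -(@reval_odd_inj _ _ srep _ _ srepN srep0 srep_inj).
  apply: contra_notT nv => H; exists (rlift v) => //.
  by rewrite (reval_ext _ (g := srep \o v ord0)) // => i; rewrite mxE.
by apply/eqP; apply: contra_notT nv => H; exists v.
Qed.

Lemma card_box_flat s :
  #|[set z | (rlift z <= rann R s)%MS]| = (p ^ \rank (rann R s))%N.
Proof.
rewrite rank_rann -[X in (X ^ _)%N](card_Fp p_pr) -card_rowg; apply: eq_card => z.
by rewrite !inE rlift_rann.
Qed.

End BoxPoints.
End Roots.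

(** * Lattice points of type B faces *)

Section FacePoints.
Variables (n p q : nat) (R : realFieldType).
Hypotheses (p_pr : prime p) (pq : p = q.*2.+1).
Variable v : 'rV[R]_n.

(** A box point in the face of v has the zeros, signs and ties of v, so it amounts to a strictly
    increasing map from this list to {1..q}. *)
Definition absvals : seq R :=
  sort <=%R (undup [seq `|v ord0 i| | i <- enum 'I_n & v ord0 i != 0]).

Local Notation a := absvals.
Local Notation x i := (v ord0 i).

Lemma absvalsP y : reflect (exists2 i, x i != 0 & y = `|x i|) (y \in a).
Proof.
rewrite mem_sort mem_undup; apply: (iffP mapP) => -[i].
  by rewrite mem_filter => /andP[i0 _] ->; exists i.
by move=> i0 ->; exists i; rewrite // mem_filter i0 mem_enum.
Qed.

Lemma uniq_absvals : uniq a.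
Proof. by rewrite sort_uniq undup_uniq. Qed.

Lemma sorted_absvals : sorted <%R a.
Proof. by rewrite sort_lt_sorted undup_uniq. Qed.

Lemma absvals_rep (j : 'I_(size a)) : exists i, (x i != 0) && (`|x i| == a`_j).
Proof.
by have /absvalsP[i i0 E] := mem_nth 0 (ltn_ord j); exists i; rewrite i0 E eqxx.
Qed.

Definition rep j := xchoose (absvals_rep j).

Lemma rep_neq0 j : x (rep j) != 0.
Proof. by have /andP[] := xchooseP (absvals_rep j). Qed.

Lemma repE j : `|x (rep j)| = a`_j.
Proof. by have /andP[_ /eqP] := xchooseP (absvals_rep j). Qed.

Definition vanishing := [seq r <- enum {: broot n} | reval (v ord0) r == 0].

Lemma mem_vanishing r : (r \in vanishing) = (reval (v ord0) r == 0).
Proof. by rewrite mem_filter mem_enum andbT. Qed.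

Lemma idx_ltn i : x i != 0 -> (index `|x i|%R a < size a)%N.
Proof. by move=> i0; rewrite index_mem; apply/absvalsP; exists i. Qed.

(* The flat spanned by the face of [v] has one coordinate for each nonzero
   absolute value of an entry of [v]. *)
Lemma rank_vanishing : \rank (rann R vanishing) = size a.
Proof.
(* Applied to v, the odd function f_j keeps the signs of the entries of absolute value a_j and kills
   the others. These vectors form the basis E, and G reads off coordinates at the
   representatives. *)
pose f (j : 'I_(size a)) (y : R) := Num.sg y * (`|y| == a`_j)%:R.
have fN j : odd_fun (f j) by move=> y; rewrite /f sgrN normrN mulNr.
have f0 j : f j 0 = 0 by rewrite /f sgr0 mul0r.
pose E : 'M[R]_(size a, n) := \matrix_(j, i) f j (x i).
pose G : 'M[R]_(n, size a) := \matrix_(i, j) ((i == rep j)%:R * Num.sg (x i)).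
have EG : E *m G = 1%:M.
  apply/matrixP => j j'; rewrite !mxE (bigD1 (rep j')) //= big1 => [|i ij].
    rewrite !mxE eqxx mul1r addr0 /f repE mulrAC -expr2 sqr_sg rep_neq0 mul1r.
    by rewrite nth_uniq ?uniq_absvals // eq_sym.
  by rewrite !mxE (negPf ij) mul0r mulr0.
have Efree : row_free E by apply/row_freeP; exists G.
suff EV : (E :=: rann R vanishing)%MS by rewrite -EV; apply/eqP.
apply/eqmxP/andP; split.
  apply/row_subP => j; apply/rannP => r; rewrite mem_vanishing => /eqP vr.
  have := reval_odd0 (fN j) (f0 j) vr.
  by rewrite (reval_ext _ (g := row j E ord0)) // => i; rewrite !mxE.
apply/rV_subP => u /rannP uV; apply/submxP.
exists (\row_j (u ord0 (rep j) * Num.sg (x (rep j)))).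
apply/rowP => i; rewrite mxE.
have [xi0|xi0] := eqVneq (x i) 0.
  rewrite big1 => [|j _]; last by rewrite !mxE /f xi0 sgr0 mul0r mulr0.
  have := uV (i, None); rewrite mem_vanishing /reval /= xi0 addr0 eqxx => /(_ isT).
  by rewrite addr0.
pose j0 := Ordinal (idx_ltn xi0).
have aj0 : a`_j0 = `|x i| by rewrite nth_index // -index_mem idx_ltn.
rewrite (bigD1 j0) //= big1 => [|j jj0]; last first.
  rewrite !mxE /f -aj0 nth_uniq ?uniq_absvals //.
  by rewrite eq_sym -val_eqE /= in jj0 *; rewrite (negPf jj0) !mulr0.
rewrite !mxE /f -aj0 eqxx mulr1 addr0 -mulrA.
have := repE j0; rewrite aj0 => /eqP; rewrite eqr_norm2 => /orP[/eqP E1|/eqP E1].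
  rewrite E1 -expr2 sqr_sg xi0 mulr1.
  have := uV (i, Some (true, rep j0)); rewrite mem_vanishing /reval /= E1 subrr eqxx.
  by move=> /(_ isT)/eqP; rewrite subr_eq0 => /eqP.
rewrite E1 sgrN mulNr -expr2 sqr_sg xi0 mulrN1.
have := uV (i, Some (false, rep j0)); rewrite mem_vanishing /reval /= E1 subrr eqxx.
by move=> /(_ isT)/eqP; rewrite addr_eq0 => /eqP.
Qed.

(** The sign of y + y' is the comparison of y with -y', which an odd increasing map preserves. *)
Lemma sgo_oddfun (G : R -> R) (A : pred R) : odd_fun G -> (forall y, A y -> A (- y)) ->
  (forall y y', A y -> A y' -> y < y' -> G y < G y') ->
  forall y y', A y -> A y' -> sgo (G y + G y') = sgo (y + y').
Proof.
move=> GN AN Gm y y' Ay Ay'; apply/eqP/sgoP.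
have [H|H|H] := ltgtP y (- y').
- have /eqP -> : sgo (y + y') == Some false by apply/sgoP; lra.
  by have := Gm _ _ Ay (AN _ Ay') H; rewrite GN; lra.
- have /eqP -> : sgo (y + y') == Some true by apply/sgoP; lra.
  by have := Gm _ _ (AN _ Ay') Ay H; rewrite GN; lra.
- by rewrite H addNr GN addNr /sgo eqxx.
Qed.

Definition same_face (z : 'rV['F_p]_n) :=
  [forall r : broot n, sgo (reval (rlift R q z ord0) r) == sgo (reval (v ord0) r)].

(** The successor moves the values of 'I_q to {1..q}, the absolute values possible for nonzero
    entries. *)
Definition tval_at (t : (size a).-tuple 'I_q) (y : R) : nat :=
  (nth 0%N [seq nat_of_ord i | i <- t] (index y a)).+1.

Definition tpoint (t : (size a).-tuple 'I_q) : 'rV['F_p]_n :=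
  \row_i if x i == 0 then 0 else
         if 0 < x i then (tval_at t `|x i|)%:R else - (tval_at t `|x i|)%:R.

Definition tfun t (y : R) : R := if y == 0 then 0 else
  if 0 < y then (tval_at t `|y|)%:R else - (tval_at t `|y|)%:R.

Lemma tfun_odd t : odd_fun (tfun t).
Proof.
move=> y; rewrite /tfun oppr_eq0 normrN oppr_gt0; case: ltgtP => // _.
  by rewrite opprK.
by rewrite oppr0.
Qed.

Lemma tval_at_le t i : x i != 0 -> (tval_at t `|x i|%R <= q)%N.
Proof.
move=> xi; have szt : (index `|x i|%R a < size t)%N by rewrite size_tuple idx_ltn.
have [j0 _] : exists j : 'I_q, True.
  by case: t szt => -[|j t] //= *; exists j.
by rewrite /tval_at (nth_map j0).
Qed.

Lemma srep_tpoint t i : srep R q (tpoint t ord0 i) = tfun t (x i).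
Proof.
rewrite mxE /tfun; case: ifP => [_|/negbT xi]; first by rewrite (srep0 _ p_pr pq).
have le := tval_at_le t xi.
by case: ifP => _; rewrite ?(srepN _ p_pr pq) (srep_nat _ p_pr pq).
Qed.

(** The sign of |b| - |c| is that of b^2 - c^2 = (b - c)(b + c), so the roots determine the order of
    the absolute values. *)
Lemma sgo_norm_sub (b c b' c' : R) : sgo (b - c) = sgo (b' - c') ->
  sgo (b + c) = sgo (b' + c') -> sgo (`|b| - `|c|) = sgo (`|b'| - `|c'|).
Proof.
suff H (d e : R) : sgo (`|d| - `|e|) = match sgo (d - e), sgo (d + e) with
    Some s1, Some s2 => Some (s1 == s2) | _, _ => None end.
  by move=> E1 E2; rewrite !H E1 E2.
apply/eqP/sgoP; case E1 : (sgo (d - e)) => [[]|]; case E2 : (sgo (d + e)) => [[]|] /=;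
  move/eqP/sgoP : E1 => E1; move/eqP/sgoP : E2 => E2;
  by case: (ger0P d) => D; case: (ger0P e) => E; lra.
Qed.

Lemma norm_srep (b : 'F_p) : `|srep R q b| = (sabs q b)%:R :> R.
Proof. by case: (srepE R q p_pr b) => -[-> _]; rewrite ?normrN normr_nat. Qed.

Lemma same_face_norm z i i' : same_face z ->
  sgo ((sabs q (z ord0 i))%:R - (sabs q (z ord0 i'))%:R : R) = sgo (`|x i| - `|x i'|).
Proof.
move=> /forallP zv; rewrite -!norm_srep; apply: sgo_norm_sub.
  by have /eqP := zv (i, Some (true, i')); rewrite /reval /= !mxE.
by have /eqP := zv (i, Some (false, i')); rewrite /reval /= !mxE.
Qed.

Lemma same_face_sgo z i : same_face z -> sgo (srep R q (z ord0 i)) = sgo (x i).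
Proof.
move=> /forallP zv; have /eqP := zv (i, None).
by rewrite /reval /= !addr0 mxE.
Qed.

Lemma tpoint_same_face (t : (size a).-tuple 'I_q) : sorted ltn [seq nat_of_ord i | i <- t] ->
  same_face (tpoint t).
Proof.
move=> tS; pose A := [pred y : R | (y == 0) || (`|y| \in a)].
have tm y y' : y \in a -> y' \in a -> y < y' -> (tval_at t y < tval_at t y')%N.
  move=> ya ya' yy'; rewrite /tval_at ltnS.
  apply: (sorted_ltn_nth ltn_trans) => //; rewrite ?inE ?size_map ?size_tuple ?index_mem //.
  by rewrite -(lt_sorted_ltn_nth 0 sorted_absvals) ?inE ?index_mem // !nth_index.
have Gm y y' : A y -> A y' -> y < y' -> tfun t y < tfun t y'.
  rewrite /A /= /tfun => Ay Ay' yy'.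
  have pos w : (0 : R) < (tval_at t w)%:R by rewrite ltr0n.
  have := pos `|y|; have := pos `|y'|.
  have [y0|y0|y0] := ltgtP y 0; have [y0'|y0'|y0'] := ltgtP y' 0 => P P'; try lra.
    rewrite ltrN2 ltr_nat tm //.
    - by move: Ay'; rewrite lt_eqF.
    - by move: Ay; rewrite lt_eqF.
    - by rewrite !ltr0_norm // ltrN2.
  rewrite ltr_nat tm //.
  - by move: Ay; rewrite gt_eqF.
  - by move: Ay'; rewrite gt_eqF.
  - by rewrite !gtr0_norm.
have AN y : A y -> A (- y) by rewrite /A /= oppr_eq0 normrN.
have Ax i : A (x i).
  by rewrite /A /=; case: eqVneq => //= xi; apply/absvalsP; exists i.
have A0 : A 0 by rewrite /A /= eqxx.
have S := sgo_oddfun (tfun_odd t) AN Gm.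
apply/forallP => r; apply/eqP.
rewrite (reval_ext _ (g := tfun t \o v ord0)) => [|i]; last by rewrite mxE srep_tpoint.
rewrite /reval /=; case: r.2 => [[[] j]|].
- by rewrite -tfun_odd S ?AN.
- by rewrite S.
- by have := S _ _ (Ax r.1) A0; rewrite {2}/tfun eqxx.
Qed.

Lemma tpoint_inj : {in [set t : (size a).-tuple 'I_q | sorted ltn [seq nat_of_ord i | i <- t]] &,
  injective tpoint}.
Proof.
move=> t t' _ _ tt'; apply: eq_from_tnth => j.
have := congr1 (fun z : 'rV_n => srep R q (z ord0 (rep j))) tt'.
rewrite !srep_tpoint => E.
have {}E : tval_at t `|x (rep j)| = tval_at t' `|x (rep j)|.
  move: E; rewrite /tfun (negPf (rep_neq0 j)); case: ifP => _ /eqP.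
    by rewrite eqr_nat => /eqP.
  by rewrite eqr_opp eqr_nat => /eqP.
move: E; rewrite /tval_at repE index_uniq ?uniq_absvals // => -[].
rewrite !(nth_map (tnth t j)) ?size_tuple // -!tnth_nth => E.
exact: val_inj.
Qed.

Lemma same_face_tpoint z : same_face z ->
  exists2 t : (size a).-tuple 'I_q, sorted ltn [seq nat_of_ord i | i <- t] & z = tpoint t.
Proof.
move=> zv.
have pos i : x i != 0 -> (0 < sabs q (z ord0 i))%N.
  move=> xi; rewrite lt0n -(pnatr_eq0 R) -norm_srep normr_eq0 -sgo_eq0.
  by rewrite same_face_sgo // sgo_eq0.
have lt_q j : ((sabs q (z ord0 (rep j))).-1 < q)%N.
  by rewrite prednK ?pos ?rep_neq0 // (sabs_le p_pr pq).
pose t := [tuple Ordinal (lt_q j) | j < size a].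
have tE j d : (j < size a)%N -> exists2 j' : 'I_(size a), nat_of_ord j' = j &
    nth d [seq nat_of_ord i | i <- t] j = (sabs q (z ord0 (rep j'))).-1.
  move=> jk; exists (Ordinal jk) => //.
  rewrite (nth_map (tnth t (Ordinal jk))) ?size_tuple //.
  by rewrite -[X in nth _ _ X]/(nat_of_ord (Ordinal jk)) -tnth_nth tnth_mktuple.
exists t.
  apply/(sortedP 0%N) => j; rewrite size_map size_tuple => jk.
  have [j1 j1E ->] := tE j 0%N (ltnW jk); have [j2 j2E ->] := tE j.+1 0%N jk.
  have P1 := pos _ (rep_neq0 j1); have P2 := pos _ (rep_neq0 j2).
  suff : (sabs q (z ord0 (rep j1)) < sabs q (z ord0 (rep j2)))%N by lia.
  rewrite -(ltr_nat R) -subr_lt0; apply/(sgoP _ (Some false)).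
  rewrite same_face_norm //; apply/sgoP; rewrite subr_lt0 !repE j1E j2E.
  by move/(sortedP 0) : sorted_absvals; apply.
apply/rowP => i; apply: (@srep_inj R _ q p_pr); rewrite srep_tpoint /tfun.
have sgz := same_face_sgo i zv.
case: eqVneq => [xi|xi].
  by apply/eqP; rewrite -sgo_eq0 sgz xi sgo_eq0.
have [j jE] := tE _ 0%N (idx_ltn xi).
rewrite /tval_at => ->; rewrite prednK ?pos ?rep_neq0 //.
have -> : sabs q (z ord0 (rep j)) = sabs q (z ord0 i).
  apply/eqP; rewrite -(eqr_nat R) -subr_eq0 -sgo_eq0 same_face_norm // sgo_eq0.
  by rewrite repE jE nth_index ?subrr // -index_mem idx_ltn.
case: ltP => x0.
  have {}sgz : 0 < srep R q (z ord0 i).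
    by apply/(sgoP _ (Some true)); rewrite sgz; apply/sgoP.
  by rewrite -norm_srep gtr0_norm.
have {}sgz : srep R q (z ord0 i) < 0.
  by apply/(sgoP _ (Some false)); rewrite sgz; apply/sgoP; rewrite lt_neqAle xi.
by rewrite -norm_srep ltr0_norm // opprK.
Qed.

Lemma card_same_face :
  #|[set z | same_face z]| = 'C(q, \rank (rann R vanishing)).
Proof.
rewrite rank_vanishing -card_ltn_sorted_tuples -(card_in_imset tpoint_inj).
apply: eq_card => z; rewrite !inE; apply/idP/imsetP => [/same_face_tpoint[t tS ->]|[t]].
  by exists t; rewrite // inE.
by rewrite inE => /tpoint_same_face + ->.
Qed.

End FacePoints.

(** * Levels and regions *)

Local Open Scope classical_set_scope.
Local Open Scope ring_scope.

Section Geometry.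
Variables (R : realType) (n : nat).
Notation form := ('cV[R]_n * R)%type.
Notation constr := (form * option bool)%type.
Implicit Types (h : form) (p : constr) (c d : seq constr) (x y z u v w : 'rV[R]_n).

Lemma continuous_sum_seq (I : Type) (T : topologicalType) (f : I -> T -> R) (r : seq I) :
  (forall i, continuous (f i)) -> continuous (fun t => \sum_(i <- r) f i t).
Proof.
move=> fc; elim: r => [|i r IHr].
  by under eq_fun do rewrite big_nil; exact: cst_continuous.
under eq_fun do rewrite big_cons.
by move=> t; apply: cvgD; [exact: fc|exact: IHr].
Qed.

Lemma dot_continuous (g : 'cV[R]_n) : continuous (fun y : 'rV[R]_n => dot y g).
Proof.
under eq_fun do rewrite /dot mxE.
apply: continuous_sum_seq => j y.
by apply: continuousM; [exact: coord_continuous|exact: cst_continuous].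
Qed.

Lemma ev_continuous h : continuous (ev h).
Proof.
rewrite (_ : ev h = (fun y => dot y h.1) \- (fun=> h.2)) // => y.
by apply: continuousB; [exact: dot_continuous|exact: cst_continuous].
Qed.

Lemma coord_le_norm y i : `|y ord0 i| <= `|y|.
Proof.
rewrite [leRHS]/Num.Def.normr /= mx_normrE; apply/bigmax_geP; right => /=.
by exists (ord0, i).
Qed.

(** Zero only where the weak sign condition holds, positively homogeneous, and bounded on a cell
    even where t is not. *)
Definition penalty (s : option bool) (t : R) : R :=
  `|t| - (if s is Some b then (if b then t else - t) else 0).

Lemma penalty_ge0 s t : 0 <= penalty s t.
Proof.
by rewrite /penalty; case: s => [[]|]; case: (ger0P t); lra.
Qed.

Lemma penalty_eq0 s t : penalty s t = 0 -> wk s t.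
Proof.
move=> H; apply/wkP; move: H; rewrite /penalty; case: s => [[]|];
  by case: (ger0P t); lra.
Qed.

Lemma penaltyZ s a t : 0 <= a -> penalty s (a * t) = a * penalty s t.
Proof.
move=> a0; rewrite /penalty normrM (ger0_norm a0).
by case: s => [[]|]; ring.
Qed.

Lemma penalty_le s t (a : R) : sgo (t - a) = s -> penalty s t <= 2 * `|a|.
Proof.
move=> /eqP/sgoP; rewrite /penalty; case: s => [[]|] H;
  by case: (ger0P t) => ?; case: (ger0P a) => ?; lra.
Qed.

Lemma norm_dot_continuous (g : 'cV[R]_n) : continuous (fun y : 'rV[R]_n => `|dot y g|).
Proof.
move=> y; apply: (@continuous_comp _ _ _ (fun y => dot y g) Num.Def.normr).
  exact: dot_continuous.
exact: norm_continuous.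
Qed.

Lemma penalty_continuous s (g : 'cV[R]_n) :
  continuous (fun y : 'rV[R]_n => penalty s (dot y g)).
Proof.
have dc := @dot_continuous g; have nc := @norm_dot_continuous g.
have sub (f f' : 'rV[R]_n -> R) : continuous f -> continuous f' ->
    continuous (fun y => f y - f' y).
  by move=> fc fc' y; exact: (continuousB (fc y) (fc' y)).
rewrite /penalty; case: s => [[]|]; apply: sub => //; last exact: cst_continuous.
by move=> y; exact: (continuousN (dc y)).
Qed.

(* The total penalty is positive on the unit sphere of a complement of the lineality
   space, which is compact, and it is bounded on the cell. *)
Lemma cell_near_ann d : lin d -> exists2 M, 0 <= M & forall x, in_cell d x ->
  exists2 w, (w <= ann (normals d))%MS & `|x - w| <= M.
Proof.
move=> /linP dl; pose N := ann (normals d); pose N' := (N^C)%MS.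
pose F y := \sum_(p <- d) penalty p.2 (dot y p.1.1).
have Fc : continuous F.
  by apply: continuous_sum_seq => p; exact: penalty_continuous.
have F_ge0 y : 0 <= F y by apply: sumr_ge0 => p _; exact: penalty_ge0.
have FZ a y : 0 <= a -> F (a *: y) = a * F y.
  by move=> a0; rewrite /F mulr_sumr; apply: eq_bigr => p _; rewrite dotZ penaltyZ.
have Fle y x : in_cell d x -> (x - y <= N)%MS -> F y <= \sum_(p <- d) 2 * `|p.1.2|.
  move=> /allP xd xy; rewrite /F !big_seq; apply: ler_sum => p pd.
  apply: penalty_le; rewrite -(eqP (xd _ pd)) /ev; congr (sgo (_ - _)).
  move/in_annP : xy => /(_ _ pd); rewrite dotD dotN => /eqP.
  by rewrite subr_eq0 => /eqP.
have NN' x : exists2 y, (y <= N')%MS & (x - y <= N)%MS.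
  have : (x <= N + N')%MS by rewrite submx_full // addsmx_compl_full.
  move=> /sub_addsmxP[[D D'] /= ->]; exists (D' *m N'); first exact: submxMl.
  by rewrite addrK submxMl.
pose A : set 'rV[R]_n := [set y | (y <= N')%MS /\ `|y| = 1].
have Fpos y : A y -> 0 < F y.
  move=> [yN y1]; rewrite lt_neqAle F_ge0 andbT; apply/eqP => /esym F0.
  have : (y <= N)%MS.
    apply: dl; apply/allP => p pd; apply: penalty_eq0; apply/eqP.
    by move/eqP : F0; rewrite psumr_eq0 => [/allP/(_ _ pd)|p' _] //; exact: penalty_ge0.
  move=> yN1; have : (y <= N :&: N')%MS by rewrite sub_capmx yN1.
  rewrite capmx_compl submx0 => /eqP y0; move: y1; rewrite y0 normr0.
  by move=> /esym/eqP; rewrite oner_eq0.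
have subN' y : (y <= N')%MS = (\sum_(j < n) `|dot y (col j (cokermx N'))| == 0).
  rewrite submxE psumr_eq0 //; apply/idP/allP => [yN j _|H].
    by rewrite /= normr_eq0 dot_eq0 colE mulmxA (eqP yN) mul0mx eqxx.
  apply/eqP/rowP => j; have := H j (mem_index_enum _).
  by rewrite /= normr_eq0 /dot colE mulmxA -colE !mxE => /eqP.
have Acl : closed A.
  rewrite (_ : A =
      (fun y => \sum_(j < n) `|dot y (col j (cokermx N'))|) @^-1` [set t | t = 0]
      `&` (fun y => `|y|) @^-1` [set t | t = 1]); last first.
    by apply/seteqP; split=> y /= [yN y1]; split=> //; move: yN; rewrite subN' => /eqP.
  apply: closedI; apply: preimage_closed; try exact: closed_eq.
    by move=> y _; apply: continuous_sum_seq => j; exact: norm_dot_continuous.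
  by move=> y _; exact: norm_continuous.
have Abd : bounded_set A.
  by exists 1; split => // M M1 y [_ y1]; rewrite /= y1; exact: ltW.
have [m m0 Hm] : exists2 m, 0 < m & forall y, (y <= N')%MS -> m * `|y| <= F y.
  (* The sphere is empty when the complement is zero; any constant then works. *)
  have [A0|nA] := pselect (A !=set0); last first.
    exists 1 => // y yN; have [->|y0] := eqVneq y 0; first by rewrite normr0 mulr0.
    exfalso; apply: nA; exists (`|y|^-1 *: y); split; first exact: scalemx_sub.
    by rewrite normrZ normfV normr_id mulVf // normr_eq0.
  have Fw : {within A, continuous F} by apply: continuous_subspaceT.
  have [y0 Ay0 ymin] := EVT_min_rV A0 (bounded_closed_compact Abd Acl) Fw.
  exists (F y0); first exact: Fpos (set_mem Ay0).
  move=> y yN; have [->|yn0] := eqVneq y 0; first by rewrite normr0 mulr0.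
  have yy : 0 < `|y| by rewrite normr_gt0.
  have Ay : A (`|y|^-1 *: y).
    split; first exact: scalemx_sub.
    by rewrite normrZ normfV normr_id mulVf // gt_eqF.
  have := ymin _ (mem_set Ay); rewrite FZ ?invr_ge0 //.
  by rewrite mulrC ler_pdivlMr // mulrC.
pose S := \sum_(p <- d) 2 * `|p.1.2|.
have S0 : 0 <= S by apply: sumr_ge0 => p _; rewrite mulr_ge0.
exists (S / m); first by rewrite divr_ge0 // ltW.
move=> x xd; have [y yN xy] := NN' x; exists (x - y) => //.
rewrite opprB addrC subrK ler_pdivlMr // mulrC.
exact: le_trans (Hm _ yN) (Fle _ _ xd xy).
Qed.

End Geometry.

(** * Levels of cells, and cells as connected components *)

Section Levels.
Variables (R : realType) (n : nat).
Notation form := ('cV[R]_n * R)%type.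
Notation constr := (form * option bool)%type.
Implicit Types (h : form) (p : constr) (c d : seq constr) (x y z u v w : 'rV[R]_n).

Lemma enorm_le y M : `|y| <= M -> enorm y <= Num.sqrt (n%:R * M ^+ 2).
Proof.
move=> yM; rewrite /enorm ler_wsqrtr //.
rewrite -[n in n%:R]card_ord mulr_natl -sumr_const; apply: ler_sum => i _.
rewrite -[leLHS]real_normK ?num_real //.
by rewrite lerXn2r ?nnegrE // ?(le_trans (coord_le_norm y i)) // (le_trans _ yM).
Qed.

Lemma coord_le_enorm y i : `|y ord0 i| <= enorm y.
Proof.
rewrite -sqrtr_sqr /enorm ler_wsqrtr // (bigD1 i) //= lerDl.
by apply: sumr_ge0 => j _; exact: sqr_ge0.
Qed.

Lemma dot_le_enorm y (g : 'cV[R]_n) : `|dot y g| <= enorm y * \sum_i `|g i ord0|.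
Proof.
rewrite /dot mxE mulr_sumr; apply: le_trans (ler_norm_sum _ _ _) _.
by apply: ler_sum => i _; rewrite normrM ler_wpM2r // coord_le_enorm.
Qed.

Lemma edist_le x w (W : set 'rV[R]_n) : W w -> Defs.edist x W <= enorm (x - w).
Proof.
move=> Ww; apply: ge_inf; last by exists w.
by exists 0 => _ [w' _ <-]; exact: sqrtr_ge0.
Qed.

Lemma edist_adherent x (W : set 'rV[R]_n) (r : R) : W !=set0 -> Defs.edist x W <= r ->
  exists2 w, W w & enorm (x - w) < r + 1.
Proof.
move=> [w0 Ww0] xr; have hi : has_inf [set enorm (x - w) | w in W].
  split; first by exists (enorm (x - w0)), w0.
  by exists 0 => _ [w' _ <-]; exact: sqrtr_ge0.
have [_ [w Ww <-] H] := inf_adherent ltr01 hi.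
by exists w => //; apply: lt_le_trans H _; rewrite lerD2r.
Qed.

(** A linear form that vanishes on A but not at v is unbounded on the ray, yet bounded near A. *)
Lemma ray_near_subspace x v (A : 'M[R]_n) (r : R) :
  (forall s, 0 <= s -> Defs.edist (x + s *: v) (rowspace A) <= r) -> (v <= A)%MS.
Proof.
move=> H; apply: contrapT => nvA.
have [j vj] : exists j, dot v (col j (cokermx A)) != 0.
  apply: contrapT => nj; apply: nvA; rewrite submxE; apply/eqP/rowP => j.
  have -> : (v *m cokermx A) ord0 j = dot v (col j (cokermx A)).
    by rewrite /dot colE mulmxA -colE [RHS]mxE.
  by rewrite mxE; apply/eqP; apply: contra_notT nj => ?; exists j.
set g := col _ _ in vj.
have Ag w : (w <= A)%MS -> dot w g = 0.
  rewrite submxE => /eqP w0; apply/eqP.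
  by rewrite dot_eq0 /g colE mulmxA w0 mul0mx.
pose B := (r + 1) * \sum_i `|g i ord0|.
have bound s : 0 <= s -> `|dot x g + s * dot v g| <= B.
  move=> s0; have A0 : rowspace A !=set0 by exists 0; exact: sub0mx.
  have [w wA wr] := edist_adherent A0 (H _ s0).
  have -> : dot x g + s * dot v g = dot (x + s *: v - w) g.
    by rewrite !dotD dotN (Ag _ wA) subr0 dotZ.
  apply: le_trans (dot_le_enorm _ _) _; rewrite ler_wpM2r ?sumr_ge0 //.
  exact: ltW.
have vg : 0 < `|dot v g| by rewrite normr_gt0.
have B0 : 0 <= B by apply: le_trans (bound 0 (lexx 0)).
(* Chosen so that the form exceeds B in absolute value by at least 1 at time s. *)
pose s := (B + `|dot x g| + 1) / `|dot v g|.
have s0 : 0 <= s by rewrite divr_ge0 // addr_ge0 // addr_ge0.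
have := bound s s0.
have := lerB_normD (s * dot v g) (dot x g).
rewrite normrM (ger0_norm s0) divfK ?gt_eqF // [s * _ + _]addrC.
lra.
Qed.

Definition cell c : set 'rV[R]_n := [set x | in_cell c x].

Lemma face_dir_perturb c v u : in_rec c v -> (u <= ann (normals (along v c)))%MS ->
  exists2 e, 0 < e & in_rec c (v + e *: u).
Proof.
move=> vc uc; suff [e e0 /(_ e)] : exists2 e, 0 < e &
    forall e', `|e'| <= e -> in_rec c (v + e' *: u).
  by rewrite (ger0_norm (ltW e0)) lexx => /(_ isT) H; exists e.
elim: c vc uc => [|[h s] c IHc] /=; first by exists 1.
move=> /andP[vs vc]; rewrite /along /=.
have [vh|vh] := eqVneq (dot v h.1) 0.
  rewrite in_ann_cons => /andP[/eqP uh uc].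
  have [e e0 He] := IHc vc uc; exists e => // e' ee'.
  by rewrite He // andbT dotD dotZ uh mulr0 addr0.
move=> uc; have [e e0 He] := IHc vc uc.
have [e1 e10 He1] := sgo_small (dot u h.1) vh.
exists (Num.min e e1); first by rewrite lt_min e0.
move=> e'; rewrite le_min => /andP[A B]; rewrite He // andbT dotD dotZ /wk He1 //.
by move: vs; rewrite /wk (negPf vh) /= => ->; rewrite orbT.
Qed.

Lemma cell_ray c x v (s : R) : in_cell c x -> in_rec c v -> 0 <= s ->
  in_cell c (x + s *: v).
Proof.
move=> /allP xc /allP vc s0; apply/allP => p pc.
rewrite evD dotZ sgo_wkD ?xc // (eqP (xc _ pc)).
by apply: wkZ => //; exact: vc.
Qed.

(** Upper bound: dropping the constraints outside [along v c] enlarges the cell to one that stays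
    near the span of the recession cone. Lower bound: a subspace near the cell contains every
    recession direction, hence their span. *)
Lemma level_cell c v : inhab c -> face_dir c v ->
  is_level (cell c) (face_rank c v).
Proof.
move=> /asboolP[x0 x0c] /andP[vc vl]; split.
  exists (ann (normals (along v c))); split => //.
  have [M M0 HM] := cell_near_ann vl.
  (* The square root converts the maximum norm to the Euclidean one; adding 1 makes the radius
     positive when M = 0. *)
  exists (Num.sqrt (n%:R * M ^+ 2) + 1).
    by rewrite ltr_wpDl // sqrtr_ge0.
  move=> x xc /=; have [|w wA xw] := HM x.
    by apply/allP => p; rewrite mem_filter => /andP[_]; apply/allP: p.
  apply: le_trans (edist_le _ _) _; first exact: wA.
  by rewrite ler_wpDr // enorm_le.
move=> m [A [<- [r r0 cr]]].
apply: mxrankS; apply/rV_subP => u uc.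
have near w : in_rec c w -> (w <= A)%MS.
  move=> wc; apply: (@ray_near_subspace x0 _ _ r) => s s0; apply: cr.
  exact: cell_ray.
(* Any u in the span is a multiple of a difference of two recession directions, v + e u and v. *)
have [e e0 ec] := face_dir_perturb vc uc.
have -> : u = e^-1 *: ((v + e *: u) - v).
  by rewrite addrC addKr scalerA mulVf ?gt_eqF // scale1r.
apply: scalemx_sub; apply: addmx_sub; first exact: near.
by rewrite -scaleN1r scalemx_sub // near.
Qed.

Lemma is_level_inj (X : set 'rV[R]_n) k k' : is_level X k -> is_level X k' -> k = k'.
Proof. by move=> [H1 H2] [H3 H4]; apply/eqP; rewrite eqn_leq H2 // H4. Qed.

Definition off (l : seq form) : set 'rV[R]_n :=
  [set x | forall h, h \in l -> ev h x != 0].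

Definition signs_at (l : seq form) x := [seq sgo (ev h x) | h <- l].

Lemma cell_signs_at l x y :
  reflect (forall h, h \in l -> sgo (ev h y) = sgo (ev h x))
    (in_cell (zip l (signs_at l x)) y).
Proof.
rewrite /signs_at; elim: l => [|h l IHl] /=; first by apply: (iffP idP).
apply: (iffP andP) => [[/eqP yh /IHl yl] h'|H].
  by rewrite inE => /predU1P[->|/yl].
split; first by rewrite H ?mem_head.
by apply/IHl => h' h'l; rewrite H // inE h'l orbT.
Qed.

(** A form without zeros on a connected set has constant sign there; conversely a cell is convex, so
    segments join its points. *)
Lemma component_cell l x : off l x ->
  connected_component (off l) x = cell (zip l (signs_at l x)).
Proof.
move=> xl; apply/seteqP; split=> y; rewrite /cell /=.
  move=> [B [Bx Bl Bc] By]; apply/cell_signs_at => h hl.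
  have Ic : is_interval (ev h @` B).
    apply/connected_intervalP/connected_continuous_connected => //.
    by apply: continuous_subspaceT; exact: ev_continuous.
  have zB : ~ (ev h @` B) 0.
    by move=> [b Bb b0]; have := Bl _ Bb _ hl; rewrite b0 eqxx.
  have xB : (ev h @` B) (ev h x) by exists x.
  have yB : (ev h @` B) (ev h y) by exists y.
  rewrite /sgo (negPf (xl _ hl)) (negPf (Bl _ By _ hl)); congr Some.
  have [x0|x0] := ltP 0 (ev h x); have [y0|y0] := ltP 0 (ev h y) => //; exfalso; apply: zB.
    by apply: (Ic _ _ yB xB); rewrite y0 ltW.
  by apply: (Ic _ _ xB yB); rewrite x0 ltW.
move=> /cell_signs_at yx.
pose f (t : R) := x + t *: (y - x).
have fc : continuous f.
  move=> t; exact: (@continuousD _ _ _ (cst x) _ t (@cst_continuous _ _ x t)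
    (@scalel_continuous _ _ (y - x) t)).
pose B := f @` `[0, 1].
have Bc : connected B.
  apply: connected_continuous_connected; first exact: segment_connected.
  exact: continuous_subspaceT.
have Bx : B x by exists 0; rewrite /= ?in_itv /= ?lexx ?ler01 // /f scale0r addr0.
have By : B y by exists 1; rewrite /= ?in_itv /= ?lexx ?ler01 // /f scale1r addrC subrK.
apply: (connected_component_max Bx _ Bc By).
move=> _ [t t01 <-] h hl; move: t01; rewrite /= in_itv /= => /andP[t0 t1].
have -> : ev h (f t) = (1 - t) * ev h x + t * ev h y.
  by rewrite /f /ev !(dotD, dotZ, dotN); ring.
have := xl _ hl; have /eqP := yx _ hl; case E : (sgo (ev h x)) => [[]|].
- move: E => /eqP/sgoP x0 /sgoP y0 _.
  by rewrite gt_eqF //; nra.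
- move: E => /eqP/sgoP x0 /sgoP y0 _.
  by rewrite lt_eqF //; nra.
- by move/eqP: E; rewrite sgo_eq0 => ->.
Qed.

End Levels.

(** * Moebius sums over flats *)

Section FsSums.
Variables (T : choiceType) (M : zmodType).

Lemma fsbig_sub (L : set T) (P : T -> Prop) (F : T -> M) : finite_set L ->
  \sum_(X \in [set Y | L Y /\ P Y]) F X = \sum_(X <- fset_set L | `[< P X >]) F X.
Proof.
move=> finL; have finLP : finite_set [set Y | L Y /\ P Y].
  by apply: sub_finite_set finL => Y [].
rewrite fsbig_finite // -[RHS]big_filter; apply: perm_big; apply: uniq_perm.
- exact: fset_uniq.
- by rewrite filter_uniq // fset_uniq.
move=> X; rewrite mem_filter !in_fset_set //; apply/idP/andP.
  by move=> /set_mem[LX PX]; split; [exact/asboolP|exact/mem_set].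
by move=> [/asboolP PX /set_mem LX]; apply/mem_set.
Qed.

End FsSums.

Section Moebius.
Variables (R : realType) (n : nat).
Variable L : set (set 'rV[R]_n).
Hypothesis finL : finite_set L.
Implicit Types X Y : set 'rV[R]_n.

Local Notation above X := [set Y | L Y /\ X `<` Y].

Let finite_above X : finite_set (above X).
Proof. by apply: sub_finite_set finL => Y []. Qed.

Let card_above X Y : above X Y -> (#|` fset_set (above Y)| < #|` fset_set (above X)|)%N.
Proof.
move=> [LY [XY nYX]]; apply: fproper_ltn_card; rewrite fproperE.
apply/andP; split.
  apply/fsubsetP => Z; rewrite !in_fset_set // => /set_mem[LZ [YZ nZY]].
  apply/mem_set; split=> //.
  by split; [exact: subset_trans YZ|move=> ZX; apply: nZY; exact: subset_trans XY].
apply/negP => /fsubsetP/(_ Y); rewrite !in_fset_set //.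
by move=> /(_ (mem_set (conj LY (conj XY nYX))))/set_mem[_ []].
Qed.

(** Each recursive call passes to a larger flat, which has strictly fewer flats above it, so any
    fuel beyond their number gives the same value. *)
Lemma mobius_fuelE k k' X :
  (#|` fset_set (above X)| < k)%N -> (#|` fset_set (above X)| < k')%N ->
  mobius_fuel L k X = mobius_fuel L k' X.
Proof.
elim: k k' X => [|k IHk] [|k'] X //= Xk Xk'; case: ifP => // _; congr (- _).
apply: eq_fsbigr => Y /set_mem XY; have := card_above XY => Yk.
by apply: IHk; [move: Xk|move: Xk']; rewrite ltnS; exact: leq_trans.
Qed.

Lemma mobius0E X : mobius0 L X = if X == setT then 1 else
  - \sum_(Y <- fset_set L | `[< X `<` Y >]) mobius0 L Y.
Proof.
rewrite -fsbig_sub // {1}/mobius0 /=; case: ifP => // _; congr (- _).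
have le X' : (#|` fset_set (above X')| <= #|` fset_set L|)%N.
  apply: fsubset_leq_card; apply/fsubsetP => Y; rewrite !in_fset_set //.
  by move=> /set_mem[LY _]; apply/mem_set.
apply: eq_fsbigr => Y /set_mem XY; apply: mobius_fuelE; last by rewrite ltnS.
exact: leq_trans (card_above XY) (le X).
Qed.

Lemma sum_mobius0 Y : L Y ->
  \sum_(X <- fset_set L | `[< Y `<=` X >]) mobius0 L X = (Y == setT)%:R.
Proof.
move=> LY; rewrite big_mkcond (bigD1_seq Y) ?fset_uniq ?in_fset_set //=; last exact/mem_set.
rewrite asboolT // -big_mkcondr /= mobius0E (eq_bigl (fun X => `[< Y `<` X >])); last first.
  move=> X; apply/andP/asboolP => [[/eqP nXY /asboolP YX]|[YX nXY]].
    by split=> // XY; apply: nXY; apply/seteqP.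
  by split; [apply/eqP => XY; apply: nXY; rewrite XY|exact/asboolP].
case: eqP => [YT|_]; last by rewrite addNr.
rewrite big1 ?addr0 // => X /asboolP[_]; rewrite YT => nXT.
by exfalso; apply: nXT.
Qed.

End Moebius.

(** * Flats and their dimensions *)

Section Flats.
Variables (R : realType) (n : nat).
Notation form := ('cV[R]_n * R)%type.
Implicit Types (h : form) (l S : seq form) (X : set 'rV[R]_n) (x y : 'rV[R]_n).

Definition hyp h : set 'rV[R]_n := [set x | ev h x = 0].
Definition arrangement l : set (set 'rV[R]_n) := [set H | exists2 h, h \in l & H = hyp h].
Definition flat S : set 'rV[R]_n := [set x | forall h, h \in S -> ev h x = 0].
(** A canonical system of equations for a flat; it encodes flats as sublists of [l]. *)
Definition forms_on l X := [seq h <- l | `[< X `<=` hyp h >]].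

Variable l : seq form.
Local Notation L := (intersection_poset (arrangement l)).

Lemma flat_inL S : {subset S <= l} -> flat S !=set0 -> L (flat S).
Proof.
move=> Sl S0; exists [set H | exists2 h, h \in S & H = hyp h].
  by move=> _ [h /Sl hl ->]; exists h.
split=> //; apply/seteqP; split=> x xS; first by move=> _ [h hS ->]; exact: xS.
by move=> h hS; apply: (xS (hyp h)); exists h.
Qed.

Lemma forms_on_sub X : {subset forms_on l X <= l}.
Proof. by move=> h; rewrite mem_filter => /andP[]. Qed.

Lemma flat_forms_on X : L X -> flat (forms_on l X) = X.
Proof.
move=> [S Sl [XE X0]]; apply/seteqP; split=> x; last first.
  by move=> xX h; rewrite mem_filter => /andP[/asboolP H _]; exact: H.
move=> xX; rewrite XE => H SH; have [h hl HE] := Sl _ SH; rewrite HE.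
apply: xX; rewrite mem_filter hl andbT; apply/asboolP => y; rewrite XE => /(_ _ SH).
by rewrite HE.
Qed.

Lemma finite_L : finite_set L.
Proof.
apply: (@sub_finite_set _ _
  [set flat (mask (b : (size l).-tuple bool) l) | b in setT]).
  move=> X LX; exists (map_tuple (fun h => `[< X `<=` hyp h >]) (in_tuple l)) => //=.
  by rewrite -filter_mask; exact: flat_forms_on.
by apply: finite_image; exact: finite_finset.
Qed.

Lemma flat_affine S x0 : flat S x0 ->
  flat S = [set x0 + w | w in rowspace (ann (map fst S))].
Proof.
move=> x0S; apply/seteqP; split=> x.
  move=> xS; exists (x - x0); last by rewrite addrC subrK.
  rewrite /rowspace /= sub_ann all_map; apply/allP => h hS /=.
  have := xS h hS; have := x0S h hS; rewrite /ev dotD dotN => A B; apply/eqP; lra.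
move=> [w]; rewrite /rowspace /= sub_ann all_map => /allP wS <- h hS.
by have := x0S h hS; have /eqP := wS h hS; rewrite evD => ->; rewrite addr0.
Qed.

Lemma affine_rank (p p' : 'rV[R]_n) (A A' : 'M[R]_n) :
  [set p + w | w in rowspace A] = [set p' + w | w in rowspace A'] ->
  (A <= A')%MS.
Proof.
move=> E; apply/rV_subP => u uA.
have /= H w : (w <= A)%MS -> exists2 w', (w' <= A')%MS & p' + w' = p + w.
  move=> wA; have : [set p + w | w in rowspace A] (p + w) by exists w.
  by rewrite E => -[w' wA' e]; exists w'.
have [w0 w0A e0] := H 0 (sub0mx _ _); have [w1 w1A e1] := H u uA.
have -> : u = w1 - w0.
  by apply: (addrI p); rewrite -e1 -[p in RHS]addr0 -e0 -addrA [w0 + _]addrC subrK.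
by rewrite addmx_sub // eqmx_opp.
Qed.

Lemma affdim_flat S : flat S !=set0 -> affdim (flat S) = \rank (ann (map fst S)).
Proof.
move=> [x0 x0S]; apply: xget_unique.
  by exists x0, (ann (map fst S)); split=> //; exact: flat_affine.
move=> k [p [A [<- E]]]; move: E; rewrite (flat_affine x0S) => E.
by apply/eqP; rewrite eqn_leq !mxrankS //; [exact: affine_rank E|exact: affine_rank (esym E)].
Qed.

Lemma complement_arrangement : complement (arrangement l) = off l.
Proof.
apply/seteqP; split=> x /=.
  by move=> nx h hl; apply/eqP => xh; apply: nx; exists (hyp h) => //; exists h.
by move=> xl [_ [h hl ->]] /= xh; have := xl h hl; rewrite xh eqxx.
Qed.

End Flats.

(** * Moebius weights of cells, and regions as sign vectors *)

Section Regions.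
Variables (R : realType) (n : nat).
Notation form := ('cV[R]_n * R)%type.
Implicit Types (h : form) (sg : seq (option bool)) (X : set 'rV[R]_n) (x y z : 'rV[R]_n).
Variable l : seq form.
Local Notation L := (intersection_poset (arrangement l)).

Lemma in_cell_zip sg x h s : size sg = size l -> in_cell (zip l sg) x -> h \in l ->
  ((h, s) \in zip l sg) = (sgo (ev h x) == s).
Proof.
move=> szsg /allP xc hl; apply/idP/eqP => [hs|<-]; first exact/eqP/(xc _ hs).
by have [s' hs'] := mem_zip szsg hl; rewrite (eqP (xc _ hs')).
Qed.

Lemma zip_mem (l' : seq form) sg h s : (h, s) \in zip l' sg -> h \in l'.
Proof.
elim: l' sg => [|h' l' IHl] [|s' sg] //=; rewrite !inE.
by move=> /orP[/eqP[-> _]|/IHl ->]; rewrite ?eqxx ?orbT.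
Qed.

Lemma on_cell_flat X sg x : L X -> size sg = size l -> in_cell (zip l sg) x ->
  on_cell l sg (forms_on l X) = `[< X x >].
Proof.
move=> LX szsg xc; rewrite -{2}(flat_forms_on LX); apply/allP/asboolP => H h hX.
  have := H h hX; rewrite (in_cell_zip _ szsg xc) ?(forms_on_sub hX) //.
  by rewrite sgo_eq0 => /eqP.
by rewrite (in_cell_zip _ szsg xc) ?(forms_on_sub hX) // sgo_eq0 H.
Qed.

Hypothesis nonconst : forall h, h \in l -> exists y, ev h y != 0.

Lemma sum_mobius_cell sg x : size sg = size l -> in_cell (zip l sg) x ->
  \sum_(X <- fset_set L | on_cell l sg (forms_on l X)) mobius0 L X
  = (all (fun p => p.2 != None) (zip l sg))%:R.
Proof.
(* S cuts out the smallest flat through x: a flat contains x exactly when it contains [flat S], so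
   the sum is the one that defines the Moebius function. *)
move=> szsg xc; pose S := [seq h <- l | ev h x == 0].
have xS : flat S x by move=> h; rewrite mem_filter => /andP[/eqP].
have LS : L (flat S).
  by apply: flat_inL; [move=> h; rewrite mem_filter => /andP[]|exists x].
transitivity (\sum_(X <- fset_set L | `[< flat S `<=` X >]) mobius0 L X).
  rewrite big_seq_cond [RHS]big_seq_cond; apply: eq_bigl => X.
  case: (boolP (X \in _)) => //=; rewrite in_fset_set; last exact: finite_L.
  move=> /set_mem LX; rewrite (on_cell_flat LX szsg xc).
  apply: asbool_equiv_eq; split=> [Xx|]; last by apply.
  rewrite -(flat_forms_on LX) => y yS h hX; apply: yS; rewrite mem_filter.
  rewrite (forms_on_sub hX) andbT; apply/eqP.
  by move: hX; rewrite mem_filter => /andP[/asboolP H _]; exact: H.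
rewrite (sum_mobius0 (finite_L l) LS); congr (_%:R); congr nat_of_bool.
apply/eqP/allP => [ST [h s] hs /=|nS].
  have hl : h \in l := zip_mem hs.
  have := hs; rewrite (in_cell_zip _ szsg xc hl) => /eqP <-.
  rewrite sgo_eq0; apply/negP => xh; have [y] := nonconst hl.
  have yS : flat S y by rewrite ST.
  by rewrite yS ?eqxx // mem_filter xh.
apply/seteqP; split=> // y _ h; rewrite mem_filter => /andP[xh hl].
have [s hs] := mem_zip szsg hl; have := nS _ hs; rewrite /=.
by move: hs; rewrite (in_cell_zip _ szsg xc hl) => /eqP <-; rewrite sgo_eq0 xh.
Qed.

Definition region_signs :=
  [seq sg <- signs (size l) | inhab (zip l sg) && all (fun p => p.2 != None) (zip l sg)].

(** After exchanging sums, a cell is weighted by the total Moebius value of the flats containing it,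
    which is 1 for a region and 0 for a cell inside some hyperplane. *)
Lemma sum_mobius_dir z :
  \sum_(X <- fset_set L) mobius0 L X * (z <= ann (map fst (forms_on l X)))%MS%:R
  = \sum_(sg <- region_signs) euler z (zip l sg).
Proof.
transitivity (\sum_(X <- fset_set L) \sum_(sg <- signs (size l) |
    on_cell l sg (forms_on l X)) mobius0 L X * euler z (zip l sg)).
  rewrite !big_seq; apply: eq_bigr => X; rewrite in_fset_set; last exact: finite_L.
  move=> /set_mem LX; rewrite -mulr_sumr sum_euler_flat //; first exact: forms_on_sub.
  have [S _ [_ [x xX]]] := LX; apply/asboolP; exists x; rewrite /in_cell all_map.
  by apply/allP => h hX /=; rewrite sgo_eq0; move: xX; rewrite -{1}(flat_forms_on LX) => ->.
rewrite (exchange_big_dep predT) //= big_filter [RHS]big_mkcond /=.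
rewrite !big_seq; apply: eq_bigr => sg; rewrite mem_signs => /eqP szsg.
rewrite -mulr_suml; case: (boolP (inhab _)) => [/asboolP[x xc]|nx] /=.
  by rewrite (sum_mobius_cell szsg xc); case: ifP; rewrite ?mul1r ?mul0r.
by rewrite euler_ninhab ?mulr0 //; exact: negbTE.
Qed.

Lemma region_signsP sg : reflect (exists2 x, off l x & sg = signs_at l x)
  (sg \in region_signs).
Proof.
rewrite mem_filter mem_signs; apply: (iffP idP).
  move=> /andP[/andP[/asboolP[x xc] /allP nN] /eqP szsg]; exists x.
    move=> h hl; have [s hs] := mem_zip szsg hl; have := nN _ hs; rewrite /=.
    by move: hs; rewrite (in_cell_zip _ szsg xc hl) => /eqP <-; rewrite sgo_eq0.
  move: xc szsg; rewrite /in_cell /signs_at; elim: (l) sg {nN} => [|h l' IHl] [|s sg] //=.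
  by move=> /andP[/eqP -> H] [/(IHl _ H) <-].
move=> [x xl ->]; rewrite size_map eqxx andbT.
have xc : in_cell (zip l (signs_at l x)) x by apply/cell_signs_at.
apply/andP; split; first by apply/asboolP; exists x.
apply/allP => -[h s] hs; rewrite -(eqP (allP xc _ hs)) sgo_eq0.
exact/xl/(zip_mem hs).
Qed.

Lemma regionsE C : regions (arrangement l) C <->
  exists2 sg, sg \in region_signs & C = cell (zip l sg).
Proof.
rewrite /regions complement_arrangement; split=> [[x xl ->]|[_ /region_signsP[x xl ->] ->]].
  exists (signs_at l x); last exact: component_cell.
  by apply/region_signsP; exists x.
by exists x => //; rewrite component_cell.
Qed.

Lemma cell_inj : {in region_signs &, injective (fun sg => cell (zip l sg))}.
Proof.
move=> _ _ /region_signsP[x xl ->] /region_signsP[y yl ->] E.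
have : cell (zip l (signs_at l x)) x by apply/cell_signs_at.
by rewrite E => /cell_signs_at H; apply/eq_in_map => h /H.
Qed.

Definition region_dir sg : 'rV[R]_n := sval (cid (face_dir_exists (zip l sg))).

Lemma region_dirP sg : face_dir (zip l sg) (region_dir sg).
Proof. by rewrite /region_dir; case: cid. Qed.

Definition region_rank sg := face_rank (zip l sg) (region_dir sg).

Lemma num_regions_levelE k :
  num_regions_level (arrangement l) k = count (fun sg => region_rank sg == k) region_signs.
Proof.
pose ks := [seq sg <- region_signs | region_rank sg == k].
pose F := seq_fset tt [seq cell (zip l sg) | sg <- ks].
rewrite /num_regions_level (_ : [set C | _] = [set` F]).
  rewrite set_fsetK size_seq_fset undup_id ?size_map ?size_filter //.
  rewrite map_inj_in_uniq ?filter_uniq ?uniq_signs //.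
  move=> sg sg'; rewrite mem_filter => /andP[_ A].
  by rewrite mem_filter => /andP[_ B]; apply: cell_inj.
have level sg : sg \in region_signs -> is_level (cell (zip l sg)) (region_rank sg).
  rewrite mem_filter => /andP[/andP[i _] _]; apply: level_cell => //.
  exact: region_dirP.
apply/seteqP; split=> C /=.
  move=> [/regionsE[sg sgr ->] lk]; rewrite seq_fsetE; apply: map_f.
  by rewrite mem_filter sgr andbT; apply/eqP; exact: is_level_inj (level _ sgr) lk.
rewrite seq_fsetE => /mapP[sg]; rewrite mem_filter => /andP[/eqP <- sgr] ->.
by split; [apply/regionsE; exists sg|exact: level].
Qed.

End Regions.

(** * Type B arrangements *)

Section TypeB.
Variables (R : realType) (n : nat).
Variables (as_ : 'I_n -> seq R) (bs cs : 'I_n -> 'I_n -> seq R).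
Hypotheses (has : forall i, as_ i != [::])
  (hbs : forall i j, i != j -> bs i j != [::])
  (hcs : forall i j, i != j -> cs i j != [::]).
Notation form := ('cV[R]_n * R)%type.
Implicit Types (r : broot n) (x y z u v : 'rV[R]_n).

(** Pairs with i = j are elements of [broot n] but no hyperplanes of the arrangement, hence the
    empty list. *)
Definition consts r : seq R :=
  if r.2 is Some (b, j) then
    if r.1 == j then [::] else if b then bs r.1 j else cs r.1 j
  else as_ r.1.

Definition Bforms : seq form := [seq (rvec R r, a) | r <- enum {: broot n}, a <- consts r].

Lemma mem_Bforms h : reflect (exists r a, a \in consts r /\ h = (rvec R r, a)) (h \in Bforms).
Proof.
apply: (iffP allpairsPdep) => [[r [a [_ ra ->]]]|[r [a [ra ->]]]]; first by exists r, a.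
by exists r, a; rewrite mem_enum.
Qed.

Lemma ev_rvec r a x : ev (rvec R r, a) x = reval (x ord0) r - a.
Proof. by rewrite /ev dot_rvec. Qed.

Lemma Bdeform_arrangement : Bdeform as_ bs cs = arrangement Bforms.
Proof.
have hypE r a : hyp (rvec R r, a) = [set x : 'rV[R]_n | reval (x ord0) r = a].
  apply/seteqP; split=> x; rewrite /hyp /= ev_rvec; first exact: subr0_eq.
  by move=> ->; rewrite subrr.
apply/seteqP; split=> H.
  have add r a (H' : set 'rV[R]_n) : a \in consts r -> H' = [set x : 'rV[R]_n | reval (x ord0) r = a] ->
      arrangement Bforms H'.
    move=> ra ->; exists (rvec R r, a); last by rewrite hypE.
    by apply/mem_Bforms; exists r, a.
  move=> [[i [a ia ->]]|[[i [j [ij [b ijb ->]]]]|[i [j [ij [c ijc ->]]]]]].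
  - refine (add (i, None) a _ ia _).
    by apply/seteqP; split=> x; rewrite /reval /= addr0.
  - refine (add (i, Some (true, j)) b _ _ erefl); by rewrite /consts /= (negPf ij).
  - refine (add (i, Some (false, j)) c _ _ erefl); by rewrite /consts /= (negPf ij).
move=> [h /mem_Bforms[[i [[b j]|]] [a [ra ->]]] ->]; rewrite hypE; last first.
  left; exists i, a => //.
  by apply/seteqP; split=> x; rewrite /reval /= addr0.
right; move: ra; rewrite /consts /=; have [//|ij] := eqVneq i j.
by case: b => ra; [left|right]; exists i, j; split=> //; exists a.
Qed.

Lemma Bforms_nonconst h : h \in Bforms -> exists y, ev h y != 0.
Proof.
move=> /mem_Bforms[[i o] [a [ra ->]]]; exists ((a + 1) *: delta_mx ord0 i).
rewrite ev_rvec; suff -> : reval (((a + 1) *: delta_mx ord0 i : 'rV[R]_n) ord0) (i, o) = a + 1.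
  by rewrite addrAC subrr add0r oner_eq0.
rewrite /reval !mxE !eqxx mulr1; case: o ra => [[b j]|] /=; last by rewrite addr0.
rewrite /consts /= eq_sym; have [//|ij] := eqVneq j i => _.
by rewrite !mxE eqxx (negPf ij) /= mulr0 oppr0; case: b; rewrite addr0.
Qed.

(** The entry point of non-degeneracy: every root with distinct indices is the normal of some
    hyperplane. *)
Lemma forall_Bforms (P : 'cV[R]_n -> Prop) :
  (forall h, h \in Bforms -> P h.1) <->
  (forall i, P (rvec R (i, None))) /\
  (forall i j b, i != j -> P (rvec R (i, Some (b, j)))).
Proof.
split=> [H|[H1 H2] h /mem_Bforms[[i [[b j]|]] [a [ra ->]]] /=]; last exact: H1; last first.
  by apply: H2; apply: contraTneq ra => ij; rewrite /consts /= ij eqxx.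
have HP r : consts r != [::] -> P (rvec R r).
  case E : (consts r) => [//|a s] _; apply: (H (rvec R r, a)); apply/mem_Bforms.
  by exists r, a; rewrite E mem_head.
split=> [i|i j b ij]; first by apply: HP; exact: has.
by apply: HP; rewrite /consts /= (negPf ij); case: b; [exact: hbs|exact: hcs].
Qed.

Lemma all_zip (P : form -> bool) l sg : size sg = size l ->
  all (fun p : form * option bool => P p.1) (zip l sg) = all P l.
Proof.
by move=> szsg; rewrite -[in RHS](unzip1_zip (s := l) (t := sg)) ?szsg // all_map.
Qed.

Lemma same_face_Bforms p q (z : 'rV['F_p]_n) v sg : size sg = size Bforms ->
  all (fun c : form * option bool =>
    sgo (dot (rlift R q z) c.1.1) == sgo (dot v c.1.1)) (zip Bforms sg)
  = same_face q v z.
Proof.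
move=> szsg.
rewrite (all_zip (fun h : form => sgo (dot (rlift R q z) h.1) == sgo (dot v h.1)) szsg).
set w := rlift R q z.
apply/allP/forallP => [H|H h /mem_Bforms[r [a [_ ->]]]]; last first.
  by rewrite /= !dot_rvec; exact: H.
have [H1 H2] := (forall_Bforms (fun g => sgo (dot w g) == sgo (dot v g))).1 H.
move=> [i [[b j]|]]; last by have := H1 i; rewrite !dot_rvec.
(* For i = j the root is 0 or 2 x_i, and its sign follows from that of x_i. *)
have [<-|ij] := eqVneq i j; last by have := H2 i j b ij; rewrite !dot_rvec.
case: b; rewrite /reval /=; first by rewrite !subrr.
have := H1 i; rewrite !dot_rvec /reval /= !addr0 => /eqP E.
apply/eqP; rewrite sgo_wkD ?wk_sgo // E.
by rewrite [RHS]sgo_wkD ?wk_sgo.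
Qed.

Lemma face_rank_Bforms v sg : size sg = size Bforms ->
  face_rank (zip Bforms sg) v = \rank (rann R (vanishing v)).
Proof.
move=> szsg; have annE u : (u <= ann (normals (along v (zip Bforms sg))))%MS =
    (u <= rann R (vanishing v))%MS.
  have -> : (u <= ann (normals (along v (zip Bforms sg))))%MS =
      all (fun h : form => (dot v h.1 == 0) ==> (dot u h.1 == 0)) Bforms.
    rewrite -(all_zip _ szsg); apply/in_annP/allP => H p.
      move=> pz; apply/implyP => v0; apply/eqP/H.
      by rewrite mem_filter v0.
    by rewrite mem_filter => /andP[v0 /H/implyP/(_ v0)/eqP].
  apply/allP/rannP => [H r|H h /mem_Bforms[r [a [_ ->]]]]; last first.
    rewrite /= !dot_rvec; apply/implyP => v0; apply/eqP/H.
    by rewrite mem_vanishing.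
  have [H1 H2] := (forall_Bforms (fun g => (dot v g == 0) ==> (dot u g == 0))).1 H.
  rewrite mem_vanishing; move: r => [i [[b j]|]]; last first.
    by move=> v0; have := H1 i; rewrite !dot_rvec v0 => /eqP.
  have [<-|ij] := eqVneq i j; last first.
    by move=> v0; have := H2 i j b ij; rewrite !dot_rvec v0 => /eqP.
  case: b; rewrite /reval /=; first by rewrite !subrr.
  rewrite -mulr2n mulrn_eq0 /= => v0; have := H1 i.
  by rewrite !dot_rvec /reval /= !addr0 v0 => /eqP ->; rewrite addr0.
apply/eqP; rewrite eqn_leq.
by apply/andP; split; apply: mxrankS; apply/rV_subP => u; rewrite annE.
Qed.

Lemma Bforms_roots S : {subset S <= Bforms} -> exists s, map fst S = map (rvec R) s.
Proof.
elim: S => [|h S IHS] Sl; first by exists [::].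
have [|s Es] := IHS; first by move=> h' h'S; rewrite Sl // inE h'S orbT.
have /mem_Bforms[r [a [_ ->]]] := Sl h (mem_head _ _).
by exists (r :: s); rewrite /= Es.
Qed.

Local Notation L := (intersection_poset (arrangement Bforms)).

Lemma char_poly_at_prime p q : prime p -> p = q.*2.+1 ->
  \sum_(X <- fset_set L) mobius0 L X * (p ^ affdim X)%N%:R
  = \sum_(sg <- region_signs Bforms)
      (-1) ^+ (region_rank Bforms sg + n) * 'C(q, region_rank Bforms sg)%:R.
Proof.
move=> p_pr pq.
(* Each power of p is the number of box points parallel to X; summing over z last then leaves, for
   each region, the box points in one face. *)
transitivity (\sum_(X <- fset_set L) \sum_(z : 'rV['F_p]_n)
    mobius0 L X * (rlift R q z <= ann (map fst (forms_on Bforms X)))%MS%:R).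
  rewrite !big_seq; apply: eq_bigr => X; rewrite in_fset_set; last exact: finite_L.
  move=> /set_mem LX; rewrite -mulr_sumr; congr (_ * _).
  have X0 : flat (forms_on Bforms X) !=set0.
    by rewrite flat_forms_on //; have [S _ []] := LX.
  rewrite -{1}(flat_forms_on LX) affdim_flat //.
  have [s ->] := Bforms_roots (@forms_on_sub _ _ Bforms X).
  rewrite -[ann _]/(rann R s) -(card_box_flat R p_pr pq) cardsE -sum1_card natr_sum.
  rewrite [LHS]big_mkcond /=; apply: eq_bigr => z _; rewrite unfold_in /=.
  by case: (_ <= _)%MS.
rewrite exchange_big /=.
under eq_bigr do rewrite (sum_mobius_dir Bforms_nonconst).
rewrite exchange_big /= !big_seq; apply: eq_bigr => sg.
rewrite mem_filter mem_signs => /andP[/andP[sgx sgN] /eqP szsg].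
under eq_bigr do rewrite (euler_region _ sgx sgN (region_dirP Bforms sg)) same_face_Bforms //.
rewrite -big_mkcond sumr_const -[LHS]mulr_natr; congr (_ * _%:R).
rewrite /region_rank face_rank_Bforms // -(card_same_face p_pr pq).
by apply: eq_card => z; rewrite !inE.
Qed.

End TypeB.

(** * Interpolation at odd primes *)

Lemma poly_eq_odd_primes (R : numDomainType) (P Q : {poly R}) :
  (forall p q, prime p -> p = q.*2.+1 -> P.[p%:R] = Q.[p%:R]) -> P = Q.
Proof.
move=> PQ; apply/eqP; rewrite -subr_eq0.
have [s [szs us sp]] : exists s : seq nat, [/\ size s = size (P - Q), uniq s &
    {in s, forall p, prime p && odd p}].
  elim: (size _) => [|m [s [szs us sp]]]; first by exists [::].
  (* Beyond the maximum the prime is new, and beyond 2 it is odd. *)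
  have [p ps pp] := prime_above (2 + \max_(i <- s) i).
  exists (p :: s); split; first by rewrite /= szs.
    rewrite /= us andbT; apply/negP => sp'.
    have : (p <= \max_(i <- s) i)%N by rewrite (big_rem p) //= leq_maxl.
    lia.
  move=> p'; rewrite inE => /predU1P[->|/sp//]; rewrite pp.
  by case/even_prime: pp => // E; move: ps; rewrite E; lia.
apply/eqP; apply: (@roots_geq_poly_eq0 _ _ [seq p%:R | p <- s]).
- apply/allP => _ /mapP[p /sp /andP[pp op] ->].
  rewrite /root hornerD hornerN (PQ p p./2) ?subrr //.
  by rewrite -[LHS]odd_double_half op.
- by rewrite map_inj_uniq // => a b /eqP; rewrite eqr_nat => /eqP.
- by rewrite size_map szs.
Qed.

Lemma binom_half_odd (R : realType) k q : (binom_half R k).[q.*2.+1%:R] = 'C(q, k)%:R.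
Proof.
rewrite /binom_half hornerZ horner_prod.
have k0 : k`!%:R != 0 :> R by rewrite pnatr_eq0 -lt0n fact_gt0.
apply: (mulfI k0); rewrite mulrA divff // mul1r -natrM mulnC bin_ffact.
have E : (2%:R)^-1 * (q.*2.+1%:R - 1) = q%:R :> R.
  by rewrite -[q.*2.+1]addn1 natrD addrK -mul2n natrM mulKf // pnatr_eq0.
rewrite (eq_bigr (fun i : 'I_k => q%:R - i%:R)) => [|i _]; last first.
  by rewrite hornerD hornerN hornerZ hornerD hornerN hornerX !hornerC E.
have [kq|qk] := leqP k q.
  rewrite ffact_prod natr_prod; apply: eq_bigr => i _.
  by rewrite natrB // ltnW // (leq_trans (ltn_ord i)).
(* For k > q the factor with i = q is zero. *)
by rewrite ffact_small // (bigD1 (Ordinal qk)) //= subrr mul0r.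
Qed.

Theorem theorem1p2 (R : realType) (n : nat) (hn : (0 < n)%N)
  (as_ : 'I_n -> seq R) (bs cs : 'I_n -> 'I_n -> seq R)
  (has : forall i, as_ i != [::])
  (hbs : forall i j, i != j -> bs i j != [::])
  (hcs : forall i j, i != j -> cs i j != [::]) :
  arr_char_poly (Bdeform as_ bs cs) =
  \sum_(k < n.+1) ((-1) ^+ (n - k) * (num_regions_level (Bdeform as_ bs cs) k)%:R)
                    *: binom_half R k.
Proof.
apply: poly_eq_odd_primes => p q p_pr pq; rewrite Bdeform_arrangement.
rewrite /arr_char_poly fsbig_finite; last exact: finite_L.
have := char_poly_at_prime has hbs hcs p_pr pq.
set L := intersection_poset _; set l := Bforms _ _ _.
move=> /(congr1 (fun m : int => m%:~R : R)); rewrite !rmorph_sum /= => E.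
rewrite horner_sum; transitivity (\sum_(X <- fset_set L) (mobius0 L X * (p ^ affdim X)%N%:R)%:~R : R).
  by apply: eq_bigr => X _; rewrite hornerZ hornerXn rmorphM /= rmorph_nat natrX.
rewrite E horner_sum.
have rank_le sg : (region_rank l sg < n.+1)%N by rewrite ltnS rank_leq_row.
(* The one-term inner sum sorts the regions by level once the two sums are exchanged. *)
transitivity (\sum_(sg <- region_signs l) \sum_(k < n.+1 | k == Ordinal (rank_le sg))
    ((-1) ^+ (n - k) * 'C(q, k)%:R : R)).
  apply: eq_bigr => sg _; rewrite big_pred1_eq /= rmorphM /= rmorphXn rmorphN1 rmorph_nat.
  by congr (_ * _); rewrite -[LHS]signr_odd -[RHS]signr_odd oddB ?rank_leq_row // oddD addbC.
rewrite (exchange_big_dep predT) //=; apply: eq_bigr => k _.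
rewrite hornerZ pq binom_half_odd mulrAC num_regions_levelE big_const_seq iter_addr_0.
rewrite [RHS]mulr_natr; congr (_ *+ _); apply: eq_count => sg.
by rewrite -val_eqE eq_sym.
Qed.
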